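(* Let $I$ be a non-degenerate interval and $f:I\to\mathbb{R}$ continuous. Then (i) every point at which $f$ has a derivative (finite or infinite) is an $\mathsf{M}$-point of $f$; (ii) there is a set $E\subseteq I$ with $\mathcal{H}^1(\{(x,f(x)):x\in E\})=0$ such that every $\mathsf{M}$-point of $f$ belongs to $D_{ap}(f)\cup K_{ap}(f)\cup E$. In particular, for $\mathcal{H}^1$-almost every point $(x,f(x))$ of the graph with $x$ an $\mathsf{M}$-point not in $D_{ap}(f)$, $x$ is a knot point of $f$.
   Context: $\mathcal{H}^1$ is one-dimensional Hausdorff measure in $\mathbb{R}^2$. Let $\psi(x)=(x,f(x))$, $|\cdot|$ the Euclidean norm. For $c\ge1$, $y\in I$ is an $\mathsf{M}_c$-point of $f$ if there is $\varepsilon>0$ with $|\psi(x)-\psi(y)|\le c|\psi(x)-\psi(z)|$ for all $x\in I\cap(y-\varepsilon,y)$, $z\in I\cap(y,y+\varepsilon)$; an $\mathsf{M}$-point is an $\mathsf{M}_c$-point for some $c\ge1$. The approximate upper right Dini derivative is $\overline{f}^+_{ap}(x)=\inf\{t:\lim_{\delta\to0+}\delta^{-1}\lambda(\{y\in(x,x+\delta):\frac{f(y)-f(x)}{y-x}\le t\})=1\}$ ($\lambda$ Lebesgue measure); the other three approximate Dini derivatives are defined analogously. $D_{ap}(f)$ is the set of points where all four approximate Dini derivatives coincide (the approximate derivative exists); $K_{ap}(f)$ is the set of approximate knot points, where both upper approximate Dini derivatives are $+\infty$ and both lower ones are $-\infty$. A knot point is a point where both upper Dini derivatives are $+\infty$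 and both lower Dini derivatives are $-\infty$. *)

(* Defs.v *)
From HB Require Import structures.
From mathcomp Require Import all_boot all_order all_algebra.
From mathcomp Require Import all_classical all_reals all_analysis.
Set Implicit Arguments. Unset Strict Implicit. Unset Printing Implicit Defensive.
Import Order.TTheory GRing.Theory Num.Theory.
Import numFieldNormedType.Exports.
Local Open Scope classical_set_scope.
Local Open Scope ring_scope.

Section Defs.
Variable R : realType.

Definition dist2 (p q : R * R) : R :=
  Num.sqrt ((p.1 - q.1) ^+ 2 + (p.2 - q.2) ^+ 2).

(** Diameter of a subset of R^2 (0 for the empty set). *)
Definition diam2 (C : set (R * R)) : \bar R :=
  ereal_sup ([set 0%E] `|` [set (dist2 p q)%:E | p in C & q in C]).

Definition hausdorff1_delta (d : R) (S : set (R * R)) : \bar R :=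
  ereal_inf [set (\sum_(0 <= i <oo) diam2 (C i))%E
            | C in [set C : nat -> set (R * R) |
                     S `<=` \bigcup_i C i /\ forall i, (diam2 (C i) <= d%:E)%E]].

Definition hausdorff1 (S : set (R * R)) : \bar R :=
  ereal_sup [set hausdorff1_delta d S | d in [set d : R | 0 < d]].

Definition graphpt (f : R -> R) (x : R) : R * R := (x, f x).

Definition Mc_point (I : set R) (f : R -> R) (c : R) (y : R) : Prop :=
  I y /\ exists2 e : R, 0 < e &
    forall x z, I x -> y - e < x < y -> I z -> y < z < y + e ->
      dist2 (graphpt f x) (graphpt f y) <= c * dist2 (graphpt f x) (graphpt f z).

Definition M_point (I : set R) (f : R -> R) (y : R) : Prop :=
  exists2 c : R, 1 <= c & Mc_point I f c y.

Definition dq (f : R -> R) (x y : R) : R := (f y - f x) / (y - x).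

Definition has_ext_derivative (I : set R) (f : R -> R) (x : R) : Prop :=
  exists l : \bar R,
    (fun y => (dq f x y)%:E) @ within I (nbhs x^') --> l.

Definition dini_upper_right (I : set R) f x : \bar R :=
  limf_esup (fun y => (dq f x y)%:E) (within I (x^'+)).
Definition dini_lower_right (I : set R) f x : \bar R :=
  limf_einf (fun y => (dq f x y)%:E) (within I (x^'+)).
Definition dini_upper_left (I : set R) f x : \bar R :=
  limf_esup (fun y => (dq f x y)%:E) (within I (x^'-)).
Definition dini_lower_left (I : set R) f x : \bar R :=
  limf_einf (fun y => (dq f x y)%:E) (within I (x^'-)).

Definition knot_point (I : set R) (f : R -> R) (x : R) : Prop :=
  dini_upper_right I f x = +oo%E /\ dini_upper_left I f x = +oo%E /\
  dini_lower_right I f x = -oo%E /\ dini_lower_left I f x = -oo%E.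

Definition density_one (A : R -> set R) : Prop :=
  (fun d : R => ((d^-1)%:E * lebesgue_measure (A d))%E) @ 0^'+ --> 1%E.

Definition ap_upper_right (I : set R) f x : \bar R :=
  ereal_inf [set t%:E | t in [set t : R | density_one
     (fun d => [set y | I y /\ x < y < x + d /\ dq f x y <= t])]].
Definition ap_lower_right (I : set R) f x : \bar R :=
  ereal_sup [set t%:E | t in [set t : R | density_one
     (fun d => [set y | I y /\ x < y < x + d /\ t <= dq f x y])]].
Definition ap_upper_left (I : set R) f x : \bar R :=
  ereal_inf [set t%:E | t in [set t : R | density_one
     (fun d => [set y | I y /\ x - d < y < x /\ dq f x y <= t])]].
Definition ap_lower_left (I : set R) f x : \bar R :=
  ereal_sup [set t%:E | t in [set t : R | density_one
     (fun d => [set y | I y /\ x - d < y < x /\ t <= dq f x y])]].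

Definition D_ap (I : set R) (f : R -> R) : set R :=
  [set x | I x /\ ap_upper_right I f x = ap_lower_right I f x /\
           ap_lower_right I f x = ap_upper_left I f x /\
           ap_upper_left I f x = ap_lower_left I f x].

Definition K_ap (I : set R) (f : R -> R) : set R :=
  [set x | I x /\ ap_upper_right I f x = +oo%E /\ ap_upper_left I f x = +oo%E /\
           ap_lower_right I f x = -oo%E /\ ap_lower_left I f x = -oo%E].

End Defs.

(* Main.v *)
Require Import Defs.
From HB Require Import structures.
From mathcomp Require Import all_boot all_order all_algebra.
From mathcomp Require Import all_classical all_reals all_analysis.
From mathcomp Require Import measurable_realfun ring lra.
Set Implicit Arguments.
Unset Strict Implicit.
Unset Printing Implicit Defensive.
Import Order.TTheory GRing.Theory Num.Theory.
Import numFieldNormedType.Exports.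
Local Open Scope classical_set_scope.
Local Open Scope ring_scope.

(* Removing the endpoints of [I], decompose the M-points that are not
   approximate knot points into countably many pieces on which the constants in
   the definitions are uniform.  If, say, the upper right approximate Dini
   derivative is finite on a piece, then the M-condition and the intermediate
   value theorem show that [f - C x] is nonincreasing on the piece for some
   constant [C].  The graph over the piece is then the image of a subset of the
   line under a Lipschitz map, along which almost every parameter is a density
   point of the set of parameters and a point of differentiability of the
   abscissa.  At such parameters the approximate derivative of [f] exists, or
   (when the derivative of the abscissa vanishes) [f] has an infinite
   derivative. *)

(** A Lebesgue-null set of abscissae can carry part of the graph of positive $\mathcal{H}^1$
    measure, as for singular functions, so statements for almost every abscissa are too weak. The
    parameter [s = p - h p] repairs this: for nonincreasing [h] both coordinates [p] and
    [h p = p - s] are Lipschitz in [s], so null sets of parameters give $\mathcal{H}^1$-null parts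
    of the graph. The M-condition forbids narrow peaks and valleys. If the graph climbs far to reach
    an M-point and, by the intermediate value theorem, returns to a moderate height beyond it, then
    two graph points on opposite sides of the M-point are close to each other but far from it. This
    bounds the rise of the function along a piece. Where the derivative of the abscissa vanishes, it
    controls [h] at every nearby abscissa and not only on a set of density one, so the infinite
    derivative found there is an ordinary one. *)

(** * Null sets of the Hausdorff measure in the plane *)

Section hausdorff_null.
Variable R : realType.
Implicit Types (S : set (R * R)) (A : set R).

(* The plane with the discrete measurable structure: every cover is then a
   measurable cover, so that [mu_ext diam2] is the Hausdorff content. *)
Definition plane : Type := (R * R)%type.
HB.instance Definition _ := Pointed.on plane.
HB.instance Definition _ := @isMeasurable.Build default_measure_display
  plane discrete_measurable discrete_measurable0
  discrete_measurableC discrete_measurableU.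

Definition hausdorff_content (S : set plane) : \bar R :=
  @mu_ext default_measure_display plane R (@diam2 R) S.

Lemma dist2_le (p q : R * R) : dist2 p q <= `|p.1 - q.1| + `|p.2 - q.2|.
Proof.
rewrite /dist2; move: (p.1 - q.1) (p.2 - q.2) => u v.
have uv0 : 0 <= `|u| + `|v| by rewrite addr_ge0.
rewrite -[leRHS]ger0_norm// -[leRHS]sqrtr_sqr ler_wsqrtr// sqrrD !real_normK ?num_real//.
by rewrite -addrA lerD2l lerDr mulrn_wge0// mulr_ge0.
Qed.

Lemma dist2_ge1 (p q : R * R) : `|p.1 - q.1| <= dist2 p q.
Proof. by rewrite /dist2 -sqrtr_sqr ler_wsqrtr// lerDl sqr_ge0. Qed.

Lemma dist2_ge2 (p q : R * R) : `|p.2 - q.2| <= dist2 p q.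
Proof. by rewrite /dist2 -sqrtr_sqr ler_wsqrtr// lerDr sqr_ge0. Qed.

Lemma diam2_ge0 S : (0 <= diam2 S)%E.
Proof. by apply: ereal_sup_ubound; left. Qed.

Lemma diam2_le S (k : R) : 0 <= k ->
  (forall p q, S p -> S q -> dist2 p q <= k) -> (diam2 S <= k%:E)%E.
Proof.
move=> k0 Sk; apply: ge_ereal_sup => _ [->|[p Sp [q Sq <-]]];
  by rewrite lee_fin// Sk.
Qed.

Lemma hausdorff1_delta_ge0 d S : (0 <= hausdorff1_delta d S)%E.
Proof.
apply: le_ereal_inf_tmp => _ [C _ <-].
by apply: nneseries_ge0 => *; exact: diam2_ge0.
Qed.

(* A cover of small total diameter consists of sets of small diameter. *)
Lemma hausdorff_content0 S : hausdorff_content S = 0%E -> hausdorff1 S = 0%E.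
Proof.
move=> S0; apply/eqP; rewrite eq_le; apply/andP; split; last first.
  apply: (le_trans (hausdorff1_delta_ge0 1 S)).
  by apply: ereal_sup_ubound; exists 1 => //=; exact: ltr01.
apply: ge_ereal_sup => _ [d /= d0 <-]; apply/lee_addgt0Pr => e e0; rewrite add0e.
have de0 : 0 < Num.min d e by rewrite lt_min d0 e0.
have Sfin : hausdorff_content S \is a fin_num by rewrite S0.
have [_ /= [C [_ SC] <-]] := lb_ereal_inf_adherent de0 Sfin.
rewrite -/(mu_ext _ _) -/(hausdorff_content S) S0 add0e => Cde.
have Cd i : (diam2 (C i) <= d%:E)%E.
  apply: (@le_trans _ _ (\sum_(0 <= k <oo) diam2 (C k))%E).
    rewrite (@nneseriesD1 _ _ i)//; last by move=> *; exact: diam2_ge0.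
    by rewrite leeDl// nneseries_ge0// => *; exact: diam2_ge0.
  by apply: (le_trans (ltW Cde)); rewrite lee_fin ge_min lexx.
apply: (@le_trans _ _ (\sum_(0 <= k <oo) diam2 (C k))%E).
  by apply: ereal_inf_lbound; exists C.
by apply: (le_trans (ltW Cde)); rewrite lee_fin ge_min lexx orbT.
Qed.

Lemma hausdorff_content_subset0 S T : S `<=` T ->
  hausdorff_content T = 0%E -> hausdorff_content S = 0%E.
Proof.
move=> ST T0; apply/eqP; rewrite eq_le mu_ext_ge0; last exact: diam2_ge0.
by rewrite andbT -T0; exact: le_mu_ext.
Qed.

Lemma hausdorff_content_bigcup0 (F : nat -> set plane) :
  (forall n, hausdorff_content (F n) = 0%E) ->
  hausdorff_content (\bigcup_n F n) = 0%E.
Proof.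
move=> F0; apply/eqP; rewrite eq_le mu_ext_ge0; last exact: diam2_ge0.
rewrite andbT; apply: (le_trans (@mu_ext_sigma_subadditive _ plane _ _ (@diam2_ge0) F)).
by rewrite eseries0// => n _ _; exact: F0.
Qed.

Lemma hausdorff_contentU0 S T : hausdorff_content S = 0%E ->
  hausdorff_content T = 0%E -> hausdorff_content (S `|` T) = 0%E.
Proof.
move=> S0 T0; rewrite -bigcup2E; apply: hausdorff_content_bigcup0.
move=> [|[|n]]//=; apply: mu_ext0; last exact: diam2_ge0.
apply/eqP; rewrite eq_le diam2_ge0 andbT.
by apply: diam2_le.
Qed.

Lemma lebesgue_measure_cover A (e : \bar R) : (lebesgue_measure A < e)%E ->
  exists F : nat -> R * R, [/\ forall k, (F k).1 <= (F k).2,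
    A `<=` \bigcup_k `](F k).1, (F k).2[%classic &
    (\sum_(0 <= k <oo) ((F k).2 - (F k).1)%:E < e)%E].
Proof.
move=> Ae; have : (mu_ext (@wlength R idfun) A < e)%E by exact: Ae.
rewrite outer_measure_open_itv_cover => /ereal_inf_lt[_ /= [I [/= Io AI <-]]] Ie.
have [F FI] := choice Io.
(* A covering interval with reversed endpoints is empty; the maximum makes it degenerate, so that
   its length is the difference of its endpoints. *)
exists (fun k => ((F k).1, Num.max (F k).1 (F k).2)); split => /=.
- by move=> k; rewrite le_max lexx.
- move=> x /AI[k _]; rewrite FI /= in_itv/= => /andP[x1 x2].
  by exists k => //=; rewrite in_itv/= x1 lt_max x2 orbT.
- apply: le_lt_trans Ie; apply: lee_nneseries => [k _|k _].
    by move=> _; rewrite lee_fin subr_ge0 le_max lexx.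
  rewrite FI wlength_itv/= lte_fin; case: ltP => [_|_].
    by rewrite EFinB.
  by rewrite subrr.
Qed.

Lemma hausdorff_content_lipschitz_image0 (k : R) (g : R -> plane) A : 0 <= k ->
  (forall s t, dist2 (g s) (g t) <= k * `|s - t|) ->
  lebesgue_measure.-negligible A -> hausdorff_content (g @` A) = 0%E.
Proof.
move=> k0 gk [B [mB B0 AB]].
apply: (@hausdorff_content_subset0 _ (g @` B)); first exact: image_subset.
apply/eqP; rewrite eq_le mu_ext_ge0 ?andbT; last exact: diam2_ge0.
apply/lee_addgt0Pr => e e0; rewrite add0e.
(* Dividing by [k + 1] instead of [k] also covers constant maps. *)
have k1 : 0 < k + 1 by rewrite ltr_wpDl.
have [|F [F12 BF Fe]] := @lebesgue_measure_cover B (e / (k + 1))%:E.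
  by rewrite B0 lte_fin divr_gt0.
pose C n : set plane := g @` `](F n).1, (F n).2[%classic.
apply: (@le_trans _ _ (\sum_(0 <= n <oo) diam2 (C n))%E).
  apply: ereal_inf_lbound; exists C => //; split => // _ [s /BF[n _ Fs] <-].
  by exists n => //; exists s.
apply: (@le_trans _ _ ((k + 1)%:E * (e / (k + 1))%:E)%E); last first.
  by rewrite -EFinM mulrC divfK// gt_eqF.
apply: (@le_trans _ _
    ((k + 1)%:E * \sum_(0 <= n <oo) ((F n).2 - (F n).1)%:E)%E); last first.
  by rewrite lee_pmul2l// ltW.
rewrite -nneseriesZl//; last by move=> n _; rewrite lee_fin subr_ge0.
apply: lee_nneseries => [n _|n _]; first by move=> _; exact: diam2_ge0.
rewrite -EFinM; apply: diam2_le.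
  by rewrite mulr_ge0 ?subr_ge0// ltW.
move=> _ _ [s + <-] [t + <-]; rewrite /= !in_itv/=.
move=> /andP[s1 s2] /andP[t1 t2]; apply: (le_trans (gk _ _)).
apply: ler_pM => //; first by lra.
by rewrite ler_norml; lra.
Qed.

Lemma hausdorff_content_set1 (p : plane) : hausdorff_content [set p] = 0%E.
Proof.
have -> : [set p] = (fun=> p) @` [set (0 : R)] by rewrite image_set1.
apply: (@hausdorff_content_lipschitz_image0 0) => // [s t|].
  by rewrite /dist2 !subrr !expr0n/= addr0 sqrtr0 mul0r.
by exists [set 0]; split => //; exact: lebesgue_measure_set1.
Qed.

End hausdorff_null.

(** * Almost everywhere differentiability of monotone Lipschitz functions *)

Section lipschitz_derivable.
Variable R : realType.
Local Notation mu := (@lebesgue_measure R).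

Section stieltjes.
Variables (X : R -> R).
Hypothesis X_nd : {homo X : x y / x <= y}.
Hypothesis X_lip : forall s t : R, s <= t -> X t - X s <= t - s.

Lemma nondecreasing_lipschitz_dist s t : `|X t - X s| <= `|t - s|.
Proof.
have [st|/ltW ts] := leP s t.
  by rewrite !ger0_norm ?subr_ge0 ?X_nd ?X_lip.
by rewrite distrC (distrC t) !ger0_norm ?subr_ge0 ?X_nd ?X_lip.
Qed.

Lemma nondecreasing_lipschitz_continuous : continuous X.
Proof.
move=> s; apply/cvgrPdist_le => e e0; exists e => //= t.
by move=> /ltW; exact/le_trans/nondecreasing_lipschitz_dist.
Qed.

Variables m M : R.
Hypothesis X_bnd : forall s, m <= X s <= M.

Let Xc : cumulative R R := HB.pack X
  (isCumulative.Build R _ R X X_nd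
    (right_continuousW nondecreasing_lipschitz_continuous)).

Let nu : {measure set (measurableTypeR R) -> \bar R} :=
  lebesgue_stieltjes_measure Xc.

Let nu_itv a b : a <= b -> nu `]a, b]%classic = (X b - X a)%:E.
Proof.
move=> ab; rewrite /nu/= /lebesgue_stieltjes_measure /measure_extension.
by rewrite measurable_mu_extE/= ?wlength_itv_bnd ?EFinB//; exact: is_ocitv.
Qed.

(** Both are outer measures built from the same covers by half-open intervals, on each of which [X]
    grows by at most the length. *)
Let nu_le A : (nu A <= mu A)%E.
Proof.
apply: le_ereal_inf_tmp => _ [F [mF AF] <-].
apply: (@le_trans _ _ (\sum_(0 <= k <oo) wlength X (F k))%E).
  by apply: ereal_inf_lbound; exists F.
apply: lee_nneseries => [k _ _|k _]; first exact: (wlength_ge0 Xc).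
have [->|[[a b]/= ab ->]] := (ocitvP _).1 (mF k); first by rewrite !wlength0.
by rewrite !wlength_itv_bnd ?(ltW ab)//= lee_fin X_lip ?ltW.
Qed.

Let nu_fin : fin_num_fun nu.
Proof.
apply: lty_fin_num_fun; apply: (@le_lt_trans _ _ (M - m)%:E); last exact: ltry.
rewrite -(bigcup_itvT false false).
have H : (nu \o (fun n => `]- (n%:R), n%:R]%classic)) n @[n --> \oo] -->
   nu (\bigcup_n `]- (n%:R), n%:R]%classic).
  apply: nondecreasing_cvg_mu => //; first exact: bigcup_measurable.
  by move=> *; apply/subsetPset/subset_itv; rewrite leBSide/= ?lerN2 ler_nat.
rewrite -(cvg_lim _ H)//; apply: lime_le; first by apply/cvg_ex; eexists; exact: H.
near=> n; rewrite /= nu_itv ?ge0_cp// lee_fin.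
by have := X_bnd n%:R; have := X_bnd (- n%:R); lra.
Unshelve. all: by end_near. Qed.

Let nuf : {finite_measure set (measurableTypeR R) -> \bar R} :=
  HB.pack (lebesgue_stieltjes_measure Xc)
    (Measure_isFinite.Build _ _ _ (lebesgue_stieltjes_measure Xc) nu_fin).

(** The Stieltjes measure of [X] is dominated by Lebesgue measure, and finite because [X] is
    bounded, so it has an integrable density. Up to a constant [X] is the integral of that density,
    which is differentiable almost everywhere. *)
Lemma nondecreasing_lipschitz_ae_derivable :
  {ae mu, forall s, derivable X s 1}.
Proof.
have numu : nuf `<< mu.
  apply/null_content_dominatesP => A mA A0; apply/eqP.
  by rewrite eq_le measure_ge0 andbT -A0 nu_le.
have [f [f0 ffin fint fE]] := @radon_nikodym_sigma_finite _ _ _ mu nuf numu.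
pose g := fine \o f.
have gE : EFin \o g = f by apply/funext => x /=; rewrite fineK.
have gint A : measurable A -> mu.-integrable A (EFin \o g).
  by move=> mA; rewrite gE; exact: integrableS fint.
have gloc : locally_integrable [set: R] g.
  exact: (open_integrable_locally openT (gint _ measurableT)).
pose F x := (\int[mu]_(t in `]-oo, x]) (g t))%R.
have FE x : F x = fine (nuf `]-oo, x]%classic).
  by rewrite /F /Rintegral fE//; congr fine; apply: eq_integral => t _; rewrite -gE.
have XF : X = (fun x => F x + (X 0 - F 0)).
  have XFE a b : a <= b -> X b - X a = F b - F a.
    move=> ab; rewrite !FE.
    have -> : `]-oo, b]%classic = `]-oo, a]%classic `|` `]a, b]%classic.
      by rewrite -itv_bndbnd_setU// bnd_simp.
    rewrite measureU//.
      rewrite fineD ?fin_num_measure// [in X in _ = _ + X - _]/nuf /=.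
      by rewrite nu_itv//= addrAC subrr add0r.
    by rewrite -subset0 => t/= []; rewrite !in_itv/= => ta /andP[]; rewrite ltNge ta.
  apply/funext => x; have [x0|/ltW x0] := leP 0 x.
    by have := XFE _ _ x0; lra.
  by have := XFE _ _ x0; lra.
have := FTC1Ny (fun y => gint _ (measurable_itv `]-oo, y])) gloc.
apply: filterS; first exact: (ae_filter_ringOfSetsType mu).
move=> s [ds _]; rewrite XF.
by apply: (derivableD ds); exact: derivable_cst.
Qed.

End stieltjes.
End lipschitz_derivable.

(** * Derivatives, density points and approximate derivatives *)

Section slopes.
Variable R : realType.
Local Notation mu := (@lebesgue_measure R).

Lemma lebesgue_measure_lipschitz_image (X : R -> R) (A : set R) :
  {homo X : x y / x <= y} -> (forall s t : R, s <= t -> X t - X s <= t - s) ->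
  (mu (X @` A) <= mu A)%E.
Proof.
move=> X_nd X_lip; have [->|Aoo] := eqVneq (mu A) +oo%E; first exact: leey.
apply/lee_addgt0Pr => e e0.
have Afin : mu A \is a fin_num by rewrite ge0_fin_numE ?lt_neqAle ?Aoo ?leey.
have [|F [F12 AF Fe]] := @lebesgue_measure_cover R A (mu A + e%:E)%E.
  by rewrite lteDl.
apply: le_trans (ltW Fe).
pose G k : set R := `[X (F k).1, X (F k).2]%classic.
apply: (@le_trans _ _ (mu (\bigcup_k G k))).
  apply: le_outer_measure => _ [s /AF[k _ +] <-]; rewrite /= in_itv/= => /andP[s1 s2].
  by exists k => //; rewrite /G /= in_itv/= !X_nd// ltW.
apply: (le_trans (outer_measure_sigma_subadditive mu G)).
apply: lee_nneseries => [k _ _|k _]; first exact: outer_measure_ge0.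
rewrite [leLHS](lebesgue_measure_itv `[X (F k).1, X (F k).2])/= lte_fin.
case: ifPn => _.
  by rewrite -EFinB lee_fin X_lip.
by rewrite lee_fin subr_ge0.
Qed.

Definition slope_at (X : R -> R) s D := forall e : R, 0 < e ->
  exists2 r : R, 0 < r & forall t : R, `|t - s| < r ->
    `|X t - X s - D * (t - s)| <= e * `|t - s|.

Lemma derivable_slope_at (X : R -> R) s : derivable X s 1 ->
  exists D, slope_at X s D.
Proof.
move=> /cvg_ex[D /cvgrPdist_le dX]; exists D => e e0.
have [/= r r0 Hr] := dX _ e0; exists r => // t tr.
have [->|ts] := eqVneq t s; first by rewrite !subrr mulr0 subrr normr0 mulr0.
have := Hr (t - s); rewrite /= sub0r normrN subr_eq0 ts => /(_ tr isT).
rewrite [_%:A]mulr1 subrK [_ *: _]mulrC => H.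
have -> : X t - X s - D * (t - s) = - ((D - (X t - X s) / (t - s)) * (t - s)).
  by rewrite mulrBl divfK ?subr_eq0// opprB.
by rewrite normrN normrM ler_wpM2r.
Qed.

Definition density_point (Q : set R) s := forall e : R, 0 < e ->
  exists2 r0 : R, 0 < r0 & forall r : R, 0 < r < r0 -> (mu (ball s r `\` Q) <= (e * r)%:E)%E.

Lemma ae_density_point (Q : set R) : measurable Q ->
  {ae mu, forall s, Q s -> density_point Q s}.
Proof.
move=> mQ; have := lebesgue_density mQ; apply: filterS; first exact: (ae_filter_ringOfSetsType mu).
move=> s + Qs.
rewrite indicE mem_set// => dQ e e0.
(* The ball has length [2 * r], so a density above [1 - e / 2] leaves at most [e * r] uncovered. *)
have /dQ : nbhs 1%:E [set x : \bar R | ((1 - e / 2)%:E < x)%E].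
  apply: open_nbhs_nbhs; split; first exact: open_ereal_gt_ereal.
  by rewrite /= lte_fin; lra.
move=> [/= r0 r00 Hr]; exists r0 => // r /andP[rpos rr0].
have := Hr r; rewrite /= sub0r normrN gtr0_norm// => /(_ rr0 rpos).
have br : mu (ball s r) = (r *+ 2)%:E by rewrite lebesgue_measure_ball// ltW.
have mb : measurable (ball s r) by exact: measurable_ball.
have [Qfin Dfin] : mu (Q `&` ball s r) \is a fin_num /\
    mu (ball s r `\` Q) \is a fin_num.
  have sub A : A `<=` ball s r -> mu A \is a fin_num.
    move=> Ab; rewrite ge0_fin_numE ?outer_measure_ge0//.
    apply: (@le_lt_trans _ _ (mu (ball s r))); last by rewrite br ltry.
    exact: le_outer_measure.
  by split; apply: sub => x [].
have : mu (ball s r) = (mu (Q `&` ball s r) + mu (ball s r `\` Q))%E.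
  by rewrite addeC setIC -measureDI.
rewrite br -(fineK Qfin) -(fineK Dfin) inver gt_eqF ?mulrn_wgt0//.
rewrite -EFinD -EFinM => -[H]; rewrite lte_fin ltr_pdivlMr ?mulrn_wgt0// lee_fin.
by move: H; rewrite mulr2n; nra.
Qed.

Definition off_slope (g : R -> R) (y l n d : R) : set R :=
  [set z | 0 < `|z - y| < d /\ n < `|dq g y z - l|].

(** The approximate derivative, put as density zero of the bad points, so that outer measure
    estimates suffice. *)
Definition ap_slope (g : R -> R) (y l : R) := forall n e : R, 0 < n -> 0 < e ->
  exists2 r : R, 0 < r & forall d : R, 0 < d < r ->
    (mu (off_slope g y l n d) <= (e * d)%:E)%E.

Definition slope_Ny (g : R -> R) (y : R) := forall K : R,
  exists2 r : R, 0 < r & forall z : R, 0 < `|z - y| < r -> dq g y z <= - K.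

End slopes.

(** * One piece on which the function is nonincreasing *)

(* The graph of [h] over [P] is parametrized by [s = p - h p]; the parameter
   determines the abscissa through the nondecreasing 1-Lipschitz function [X],
   a McShane extension of [p - h p |-> p].  Where [X] has positive derivative,
   [h] has an approximate derivative; where the derivative of [X] vanishes, the
   points of the graph over [P] descend steeply and leave, by the M-condition,
   no room for the rest of the graph. *)
Section monotone_piece.
Variable R : realType.
Local Notation mu := (@lebesgue_measure R).
Variables (a b c : R) (h : R -> R) (P : set R).
Hypothesis c1 : 1 <= c.
Hypothesis hcont : {in `]a, b[, continuous h}.
Hypothesis P0 : P !=set0.
Hypothesis Pab : P `<=` `]a, b[%classic.
Hypothesis h_ni : forall p q : R, P p -> P q -> p <= q -> h q <= h p.
Hypothesis hM : forall p x z : R, P p -> a < x < p -> p < z < b ->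
  `|h x - h p| <= c * (z - x + `|h x - h z|) /\
  `|h z - h p| <= c * (z - x + `|h x - h z|).

Let sg p := p - h p.
(** The McShane formula with the positive part in place of the absolute value, which makes [X]
    nondecreasing; the truncation at [a] bounds [X] below, so that its Stieltjes measure is
    finite. *)
Let u p s := Num.max a (p - Num.max 0 (sg p - s)).
Let X s := sup [set u p s | p in P].
Let Q := sg @` P.

Let Pa p : P p -> a < p. Proof. by move=> /Pab; rewrite /= in_itv/= => /andP[]. Qed.
Let Pb p : P p -> p < b. Proof. by move=> /Pab; rewrite /= in_itv/= => /andP[]. Qed.

(** As [h] is nonincreasing on [P], [sg] expands distances there; its inverse is therefore
    1-Lipschitz and can be extended. *)
Let sg_le p q : P p -> P q -> p <= q -> q - p <= sg q - sg p.
Proof. by move=> Pp Pq pq; have := h_ni Pp Pq pq; rewrite /sg; lra. Qed.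

Let u_le p s : P p -> a <= u p s <= b.
Proof.
move=> Pp; have := Pa Pp; have := Pb Pp; rewrite /u; case: (leP 0 (sg p - s)) => ? ? ?;
  by case: (leP a (p - _)) => ?; lra.
Qed.

Let u_nd p (s t : R) : s <= t -> u p s <= u p t <= u p s + (t - s).
Proof.
move=> st; rewrite /u; set A := p - _; set B := p - _.
have : A <= B <= A + (t - s).
  by rewrite /A /B; case: (leP 0 (sg p - s)); case: (leP 0 (sg p - t)); lra.
by case: (leP a A) => ?; case: (leP a B) => ?; lra.
Qed.

Let hsup s : has_sup [set u p s | p in P].
Proof.
have [p Pp] := P0; split; first by exists (u p s), p.
by exists b => _ [q Pq <-]; have /andP[] := u_le s Pq.
Qed.

Let X_ub p s : P p -> u p s <= X s.
Proof. by move=> Pp; apply: sup_upper_bound => //; exists p. Qed.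

Let X_le s v : (forall p, P p -> u p s <= v) -> X s <= v.
Proof.
move=> uv; apply: ge_sup; first by have [] := hsup s.
by move=> _ [p Pp <-]; exact: uv.
Qed.

Let X_nd : {homo X : s t / s <= t}.
Proof.
move=> s t st; apply: X_le => p Pp; apply: le_trans (X_ub t Pp).
by have /andP[] := u_nd p st.
Qed.

Let X_lip (s t : R) : s <= t -> X t - X s <= t - s.
Proof.
move=> st; rewrite lerBlDr; apply: X_le => p Pp.
by have := X_ub s Pp; have := u_nd p st; lra.
Qed.

Let X_bnd s : a <= X s <= b.
Proof.
have [p Pp] := P0; apply/andP; split; last first.
  by apply: X_le => q Pq; have /andP[] := u_le s Pq.
by apply: le_trans (X_ub s Pp); have /andP[] := u_le s Pp.
Qed.

Let X_sg p : P p -> X (sg p) = p.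
Proof.
move=> Pp; apply/eqP; rewrite eq_le; apply/andP; split; last first.
  have := X_ub (sg p) Pp; rewrite /u subrr maxxx subr0.
  by apply: le_trans; rewrite le_max lexx orbT.
apply: X_le => q Pq; rewrite /u; have := Pa Pp.
have [pq|qp] := leP p q; first have := sg_le Pp Pq pq;
  by case: (leP 0 (sg q - sg p)) => ?; case: (leP a (q - _)) => ?; lra.
Qed.

Let X_dist := nondecreasing_lipschitz_dist X_nd X_lip.
Let X_continuous := nondecreasing_lipschitz_continuous X_nd X_lip.

(** The identity holds on [Q] and passes to the closure by continuity. The closure is measurable, so
    density points are available for it whatever [P] is. *)
Let closureQ (s : R) : closure Q s -> a < X s < b -> h (X s) = X s - s.
Proof.
move=> Qs Xs; apply/eqP; rewrite -subr_eq0; apply/negPn/negP => k0.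
pose k s := h (X s) - (X s - s).
have kc : {for s, continuous k}.
  apply: cvgB; first by apply: continuous_comp; [exact: X_continuous|apply: hcont; rewrite in_itv].
  by apply: cvgB; [exact: X_continuous|exact: cvg_id].
have /kc : nbhs (k s) [set x | x != 0].
  by apply: open_nbhs_nbhs; split => //; exact: open_neq.
by move=> /Qs[_ [[p Pp <-]]] /=; rewrite /k X_sg// => /eqP; apply; rewrite /sg; lra.
Qed.

(** Let [w] be the distance from [z] to [y] and [V = 4 * c * K * w]. Parameters within [V] of [sg y]
    have abscissae within [w / 8] of [y], so the piece has points between [y] and [z] at height
    about [V] away from [h y]. If the slope at [z] exceeded [- K0], the graph would return, between
    such a point and [z], to within [K * w] of [h y]. This violates the M-condition at that point,
    since [c * (w + K * w) <= V / 2 < 3 / 4 * V]. *)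
Let slope_Ny_of_slope0 y : P y -> slope_at X (sg y) 0 ->
  density_point (closure Q) (sg y) -> slope_Ny h y.
Proof.
move=> Py dX dQ K0; have c1' := c1.
have [K [K1 KK]] : exists K : R, 1 <= K /\ K0 <= K.
  by exists (Num.max 1 K0); rewrite !le_max !lexx orbT.
have cK : 0 < 4 * c * K by rewrite !mulr_gt0// (lt_le_trans ltr01).
(* With this factor the abscissa moves by at most [w / 8] over a parameter distance [V]. *)
have eta0 : 0 < (4 * c * K)^-1 / 8 by rewrite divr_gt0 ?invr_gt0.
have [r1 r10 Hr1] := dX _ eta0.
have e0 : 0 < 16^-1 :> R by lra.
have [r2 r20 Hr2] := dQ _ e0.
pose r := Num.min (Num.min (y - a) (b - y)) (Num.min r1 r2 / (4 * c * K)).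
have r0 : 0 < r.
  by rewrite /r !lt_min !subr_gt0 Pa// Pb//= divr_gt0// lt_min r10.
exists r => // z /andP[zy0]; rewrite !lt_min => /andP[/andP[zya zyb]].
rewrite ltr_pdivlMr// lt_min => /andP[zr1 zr2].
have [w wE] : exists w : R, w = `|z - y| by eexists.
have [V VE] : exists V : R, V = w * (4 * c * K) by eexists.
rewrite -wE -?VE in zy0 zya zyb zr1 zr2.
have V0 : 0 < V by rewrite VE mulr_gt0.
have Vw : V * (4 * c * K)^-1 = w by rewrite VE mulfK// gt_eqF.
have cw : c * w + c * (K * w) <= V / 2.
  have : c * w * 1 <= c * w * K by rewrite ler_wpM2l// mulr_ge0//; lra.
  by rewrite VE; nra.
have wV : w <= V.
  have cw0 : w * 1 <= w * c by rewrite ler_wpM2l// ltW.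
  have : 0 <= c * (K * w) by rewrite !mulr_ge0//; lra.
  by lra.
(* An interval that missed [Q] would, being open, miss its closure too; its length, at least
   [V / 8], would exceed the density bound [V / 16]. *)
have pick (v1 v2 : R) : sg y - V <= v1 -> v2 <= sg y + V -> V / 8 <= v2 - v1 ->
    exists2 p, P p & v1 < sg p < v2.
  move=> uV vV uv; have [//|nQ] := pselect (exists2 p, P p & v1 < sg p < v2).
  have : (mu `]v1, v2[%classic <= (16^-1 * V)%:E)%E.
    apply: le_trans (Hr2 V _); last by rewrite V0.
    apply: le_outer_measure => t; rewrite /= in_itv/= => /andP[ut tv]; split.
      by rewrite /ball/= ltr_distlC; lra.
    move=> /(_ `]v1, v2[%classic)[].
      by apply: near_in_itvoo; rewrite in_itv/= ut.
    by move=> _ [[p Pp <-]]; rewrite /= in_itv/= => upv; apply: nQ; exists p.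
  by rewrite lebesgue_measure_itv/= lte_fin ifT ?lee_fin; lra.
have near_y p : P p -> `|sg p - sg y| < V -> `|p - y| <= w / 8.
  move=> Pp pV; have := Hr1 (sg p); rewrite !X_sg// mul0r subr0.
  move=> /(_ (lt_trans pV zr1))/le_trans; apply.
  have i0 : 0 <= (4 * c * K)^-1 by rewrite invr_ge0 ltW.
  by have := ler_wpM2r i0 (ltW pV); rewrite -Vw; lra.
have Kw : K0 * w <= K * w by rewrite ler_wpM2r// ltW.
rewrite /dq; have [yz|zy] := ltP y z.
- have {}wE : w = z - y by rewrite wE ger0_norm// subr_ge0 ltW.
  rewrite ler_pdivrMr ?subr_gt0// -wE leNgt; apply/negP => hz.
  (* This gives a point of the piece right of [y] and at least [3 / 4 * V] lower: the ordinate is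
     [p - sg p], and [w <= V] absorbs the shift [w / 8] of the abscissa. *)
  have [|||p Pp /andP[p1 p2]] := pick (sg y + 7 / 8 * V) (sg y + V); [lra..|].
  have := near_y p Pp; rewrite ltr_norml ler_norml => /(_ ltac:(lra)) py.
  have pz : p < z by lra.
  have yp : y < p.
    rewrite ltNge; apply/negP => py'; have := sg_le Pp Py py'; lra.
  have hp : h p <= h y - 3 / 4 * V by rewrite /sg in p1; lra.
  have [||z' z'pz hz'] := @IVT R h p z (h y - K * w) (ltW pz).
  + apply: continuous_in_subspaceT => t; rewrite inE/= in_itv/= => tpz.
    by apply: hcont; rewrite in_itv/=; have := Pa Pp; lra.
  + by rewrite ge_min le_max; nra.
  move: z'pz; rewrite in_itv/= => /andP[pz' z'z].
  have pz'' : p < z'.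
    by rewrite lt_neqAle pz' andbT; apply/eqP => pE; move: hz' hp; rewrite -pE; nra.
  have [||+ _] := hM Pp (_ : a < y < p) (_ : p < z' < b); [|lra|].
    by rewrite Pa.
  by rewrite hz'; rewrite !ger0_norm; nra.
- have {}zy : z < y by move: zy0; rewrite wE normr_gt0 subr_eq0 lt_neqAle zy andbT.
  have {}wE : w = y - z by rewrite wE distrC ger0_norm// subr_ge0 ltW.
  rewrite -[h z - h y]opprB -[z - y]opprB invrN mulrNN -wE ler_pdivrMr//.
  rewrite leNgt; apply/negP => hz.
  have [|||p Pp /andP[p1 p2]] := pick (sg y - V) (sg y - 7 / 8 * V); [lra..|].
  have := near_y p Pp; rewrite ltr_norml ler_norml => /(_ ltac:(lra)) py.
  have zp : z < p by lra.
  have yp : p < y.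
    by rewrite ltNge; apply/negP => yp; have := sg_le Py Pp yp; lra.
  have hp : h y + 3 / 4 * V <= h p by rewrite /sg in p2; lra.
  have [||z' z'pz hz'] := @IVT R h z p (h y + K * w) (ltW zp).
  + apply: continuous_in_subspaceT => t; rewrite inE/= in_itv/= => tpz.
    by apply: hcont; rewrite in_itv/=; have := Pb Pp; lra.
  + by rewrite ge_min le_max; nra.
  move: z'pz; rewrite in_itv/= => /andP[zz' z'p].
  have {}z'p : z' < p.
    by rewrite lt_neqAle z'p andbT; apply/eqP => pE; move: hz' hp; rewrite pE; nra.
  have [||_] := hM Pp (_ : a < z' < p) (_ : p < y < b); [lra|by rewrite yp Pb|].
  rewrite hz' distrC ger0_norm; last by nra.
  by rewrite ger0_norm; nra.
Qed.

(** On the closure of [Q] the ordinate is [X s - s], and differentiating along [s] gives the slope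
    [(D - 1) / D]. Bad abscissae come from parameters outside that closure, a set of small measure
    which the 1-Lipschitz map [X] does not enlarge. *)
Let ap_slope_of_slope y D : P y -> 0 < D -> slope_at X (sg y) D ->
  density_point (closure Q) (sg y) -> ap_slope h y (1 - D^-1).
Proof.
move=> Py D0 dX dQ n e n0 e0.
(* [eta <= D / 2] keeps the growth rate of [X] from [sg y] at least [D / 2]; [eta <= n * D ^+ 2 / 2]
   brings the slope error down to [n]. *)
have [eta [eta0 etaD etan]] : exists eta : R,
    [/\ 0 < eta, eta <= D / 2 & eta <= n * D ^+ 2 / 2].
  exists (Num.min (D / 2) (n * D ^+ 2 / 2)); rewrite !ge_min !lexx orbT; split => //.
  by rewrite lt_min !divr_gt0// mulr_gt0// exprn_gt0.
have [r1 r10 Hr1] := dX _ eta0.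
have eD0 : 0 < e * D / 3 by rewrite divr_gt0// mulr_gt0.
have [r2 r20 Hr2] := dQ _ eD0.
exists (Num.min (Num.min (y - a) (b - y)) (Num.min r1 r2 * D / 3)).
  rewrite !lt_min !subr_gt0 Pa// Pb//= divr_gt0// mulr_gt0//.
  by rewrite lt_min r10.
move=> d /andP[d0]; rewrite !lt_min => /andP[/andP[dya dyb]].
rewrite ltr_pdivlMr// -ltr_pdivrMr// lt_min => /andP[dr1 dr2].
(* At rate [D / 2], [X] covers the distance [d] within parameter distance [t]. The factor [3 / 2]
   below puts this closed range inside an open ball, and [e * D / 3] makes the final bound
   [e * d]. *)
have [t tE] : exists t : R, t = 2 * d / D by eexists.
have Dt : D * t = 2 * d by rewrite tE mulrC divfK// gt_eqF.
have rE : d * 3 / D = 3 / 2 * t by rewrite tE; lra.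
rewrite {}rE in dr1 dr2.
have t0 : 0 < t by rewrite tE divr_gt0// mulr_gt0.
have -> : e * d = e * D / 3 * (3 / 2 * t).
  have -> : e * D / 3 * (3 / 2 * t) = e * (D * t) / 2 by lra.
  by rewrite Dt; lra.
apply: le_trans (Hr2 (3 / 2 * t) _); last by rewrite dr2 andbT; lra.
apply: le_trans (lebesgue_measure_lipschitz_image _ X_nd X_lip).
apply: le_outer_measure => z [/andP[zy0 zyd] nz].
have Xy := X_sg Py.
have X1 : X (sg y - t) <= z.
  have := Hr1 (sg y - t); rewrite addrAC subrr add0r normrN gtr0_norm// Xy.
  move=> /(_ ltac:(lra)); rewrite ler_norml.
  have : eta * t <= D / 2 * t by rewrite ler_wpM2r// ltW.
  by move: zyd; rewrite ltr_norml; lra.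
have X2 : z <= X (sg y + t).
  have := Hr1 (sg y + t); rewrite addrAC subrr add0r gtr0_norm// Xy.
  move=> /(_ ltac:(lra)); rewrite ler_norml.
  have : eta * t <= D / 2 * t by rewrite ler_wpM2r// ltW.
  by move: zyd; rewrite ltr_norml; lra.
have [||s + Xs] := @IVT R X (sg y - t) (sg y + t) z _ (continuous_subspaceT X_continuous).
- by lra.
- by rewrite ge_min le_max X1 X2 orbT.
rewrite in_itv/= => st; exists s => //; split.
  by rewrite /ball/= ltr_distlC; lra.
move=> /closureQ; rewrite Xs => /(_ _)hz.
have {}hz : h z = z - s by apply: hz; move: zyd; rewrite ltr_norml; lra.
have := Hr1 s; rewrite Xs Xy => /(_ _)Hs.
have {}Hs : `|z - y - D * (s - sg y)| <= eta * `|s - sg y|.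
  by apply: Hs; rewrite ltr_norml; lra.
have zy : z - y != 0 by rewrite -normr_gt0.
have E : (dq h y z - (1 - D^-1)) * (D * (z - y)) = z - y - D * (s - sg y).
  by rewrite /dq hz /sg; field; rewrite zy gt_eqF.
have Dz : D / 2 * `|s - sg y| <= `|z - y|.
  have : `|D * (s - sg y)| <= `|z - y| + `|z - y - D * (s - sg y)|.
    by rewrite -[X in `|X| <= _](subKr (z - y)) (le_trans (ler_normB _ _)).
  rewrite normrM (gtr0_norm D0).
  have : eta * `|s - sg y| <= D / 2 * `|s - sg y| by rewrite ler_wpM2r.
  by lra.
have {}E : `|dq h y z - (1 - D^-1)| * (D * `|z - y|) = `|z - y - D * (s - sg y)|.
  by rewrite -E !normrM (gtr0_norm D0).
have : n * (D * `|z - y|) < `|dq h y z - (1 - D^-1)| * (D * `|z - y|).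
  by rewrite ltr_pM2r// mulr_gt0.
rewrite E ltNge => /negP; apply.
apply: (le_trans Hs); apply: (@le_trans _ _ (n * D ^+ 2 / 2 * `|s - sg y|)).
  by rewrite ler_wpM2r.
have -> : n * D ^+ 2 / 2 * `|s - sg y| = n * D * (D / 2 * `|s - sg y|) by ring.
by rewrite [leRHS]mulrA ler_wpM2l// ltW// mulr_gt0.
Qed.

Section parametrization.
Variables A B : R.

Let graph_param (s : R) : plane R := (X s, A * (X s - s) + B * X s).

Let graph_param_lip s t :
  dist2 (graph_param s) (graph_param t) <= (1 + 2 * `|A| + `|B|) * `|s - t|.
Proof.
apply: (le_trans (dist2_le _ _)); rewrite /graph_param/=.
rewrite [leRHS]mulrDl [in leRHS]mulrDl mul1r -[leRHS]addrA.
apply: lerD; first exact: X_dist.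
have -> : A * (X s - s) + B * X s - (A * (X t - t) + B * X t) =
  A * ((X s - X t) - (s - t)) + B * (X s - X t) by ring.
apply: (le_trans (ler_normD _ _)); apply: lerD.
  rewrite normrM [2 * _]mulrC -mulrA ler_wpM2l// (le_trans (ler_normB _ _))//.
  by have := X_dist t s; lra.
by rewrite normrM ler_wpM2l.
Qed.

(** [A] and [B] make the conclusion bear on the graph of the original function, of which [h] is a
    sheared and possibly reflected copy. Outside the null set [N] the slope [D] of [X] exists, and
    it is nonnegative because [X] is nondecreasing. *)
Lemma monotone_piece_null :
  hausdorff_content [set (p, A * h p + B * p) | p in
    [set p | P p /\ ~ ((exists l, ap_slope h p l) \/ slope_Ny h p)]] = 0%E.
Proof.
pose N := ~` [set s | derivable X s 1] `|`
  ~` [set s | closure Q s -> density_point (closure Q) s].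
have N0 : mu.-negligible N.
  apply: negligibleU.
    exact: (nondecreasing_lipschitz_ae_derivable X_nd X_lip X_bnd).
  exact: (ae_density_point (closed_measurable (@closed_closure _ Q))).
apply: (@hausdorff_content_subset0 _ _ (graph_param @` N)); last first.
  exact: (hausdorff_content_lipschitz_image0 _ graph_param_lip).
move=> _ [p [Pp npP] <-]; exists (sg p); last first.
  by rewrite /graph_param X_sg// /sg subKr.
apply: contrapT => /not_orP[/contrapT/derivable_slope_at[D dX] /contrapT dQ].
have {}dQ : density_point (closure Q) (sg p).
  by apply: dQ; apply: subset_closure; exists p.
apply: npP; have [D0|D0|D0] := ltgtP D 0.
- have D1 : 0 < - D / 2 by lra.
  have [r r0 /(_ (sg p + r / 2))] := dX _ D1.
  rewrite addrAC subrr add0r gtr0_norm ?divr_gt0// => /(_ ltac:(lra)).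
  have pr : sg p <= sg p + r / 2 by lra.
  have := X_nd pr.
  rewrite ler_norml => ?; have : D * r < 0 by rewrite nmulr_rlt0.
  by lra.
- by left; exists (1 - D^-1); exact: ap_slope_of_slope.
- by right; apply: slope_Ny_of_slope0 => //; rewrite -D0.
Qed.
End parametrization.
End monotone_piece.

(** * Approximate limits of difference quotients and the Dini derivatives *)

Section approximate_limits.
Variable R : realType.
Local Notation mu := (@lebesgue_measure R).

Definition ap_small (y : R) (B : set R) := forall e : R, 0 < e ->
  exists2 r : R, 0 < r & forall d : R, 0 < d < r ->
    (mu [set z | (0 < `|z - y| < d)%R /\ B z] <= (e * d)%:E)%E.

(** One notion for finite and infinite approximate derivatives; for infinite [l] one of the two
    clauses is vacuous. *)
Definition ap_limit (g : R -> R) (y : R) (l : \bar R) := forall t : R,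
  ((l < t%:E)%E -> ap_small y [set z | t <= dq g y z]) /\
  ((t%:E < l)%E -> ap_small y [set z | dq g y z <= t]).

Lemma ap_small_sub y (B C : set R) : (forall z, z != y -> B z -> C z) ->
  ap_small y C -> ap_small y B.
Proof.
move=> BC sC e e0; have [r r0 Hr] := sC e e0; exists r => // d /Hr.
apply: le_trans; apply: le_outer_measure => z [/andP[zy0 zyd] Bz].
by split; [rewrite zy0|apply: BC => //; rewrite -subr_eq0 -normr_gt0].
Qed.

Lemma ap_slope_limit g y l : ap_slope g y l -> ap_limit g y l%:E.
Proof.
move=> gl t; split; rewrite lte_fin => lt e e0.
  have n0 : 0 < (t - l) / 2 by lra.
  have [r r0 Hr] := gl _ e n0 e0; exists r => // d /Hr; apply: le_trans.
  apply: le_outer_measure => z [zd /= tz]; split => //.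
  by rewrite ger0_norm; lra.
have n0 : 0 < (l - t) / 2 by lra.
have [r r0 Hr] := gl _ e n0 e0; exists r => // d /Hr; apply: le_trans.
apply: le_outer_measure => z [zd /= tz]; split => //.
by rewrite distrC ger0_norm; lra.
Qed.

Lemma slope_Ny_limit g y : slope_Ny g y -> ap_limit g y -oo%E.
Proof.
move=> gy t; split=> // _ e e0; have [r r0 Hr] := gy (1 - t).
exists r => // d /andP[d0 dr].
rewrite [X in (mu X <= _)%E](_ : _ = set0) ?measure0 ?lee_fin ?mulr_ge0 ?ltW//.
rewrite -subset0 => z [/andP[zy0 zyd] /= tz].
by have := Hr z; rewrite zy0 (lt_trans zyd dr) => /(_ isT); lra.
Qed.

Lemma dq_affine (h g : R -> R) (A B y z : R) : z != y ->
  (forall x, g x = A * h x + B * x) -> dq g y z = A * dq h y z + B.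
Proof. by move=> zy gE; rewrite /dq !gE; field; rewrite subr_eq0. Qed.

Lemma ap_limit_shear (h g : R -> R) (B y : R) l :
  (forall x, g x = h x + B * x) -> ap_limit h y l -> ap_limit g y (l + B%:E).
Proof.
move=> gE hl; have {}gE x : g x = 1 * h x + B * x by rewrite gE mul1r.
move=> t; have [H1 H2] := hl (t - B); split => lt.
  apply: ap_small_sub (H1 _) => [z zy /=|].
    by rewrite (dq_affine zy gE); lra.
  by rewrite EFinB lteBrDr.
apply: ap_small_sub (H2 _) => [z zy /=|].
  by rewrite (dq_affine zy gE); lra.
by rewrite EFinB lteBlDr.
Qed.

Lemma ap_limit_opp (h g : R -> R) (y : R) l :
  (forall x, g x = - h x) -> ap_limit h y l -> ap_limit g y (- l)%E.
Proof.
move=> gE hl; have {}gE x : g x = -1 * h x + 0 * x by rewrite gE mulN1r mul0r addr0.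
move=> t; have [H1 H2] := hl (- t); split => lt.
  apply: ap_small_sub (H2 _) => [z zy /=|].
    by rewrite (dq_affine zy gE); lra.
  by rewrite EFinN lteNl.
apply: ap_small_sub (H1 _) => [z zy /=|].
  by rewrite (dq_affine zy gE); lra.
by rewrite EFinN lteNr.
Qed.

(** The sets [A d] are arbitrary, so the lower bound on their measure comes from subadditivity
    against the complement in [J d]. *)
Lemma density_one_small (J A : R -> set R) :
  (forall d, 0 < d -> mu (J d) = d%:E) -> (forall d, A d `<=` J d) ->
  (forall e : R, 0 < e -> exists2 r : R, 0 < r & forall d : R, 0 < d < r ->
    (mu (J d `\` A d) <= (e * d)%:E)%E) ->
  density_one A.
Proof.
move=> Jd AJ sA; rewrite /density_one.
have fin d : 0 < d -> mu (A d) \is a fin_num.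
  move=> d0; rewrite ge0_fin_numE ?outer_measure_ge0//.
  by apply: (@le_lt_trans _ _ (mu (J d))); [exact: le_outer_measure|rewrite Jd ?ltry].
apply/fine_cvgP; split.
  by exists 1 => //= d _ d0; rewrite fin_numM ?fin.
apply/cvgrPdist_le => e e0; have [r r0 Hr] := sA e e0; exists r => //= d.
rewrite /ball/= sub0r normrN => /[swap] d0; rewrite gtr0_norm// => dr.
have := Hr d; rewrite d0 dr => /(_ isT) H.
have le1 : (mu (A d) <= d%:E)%E by rewrite -Jd//; exact: le_outer_measure.
have le2 : (d%:E <= mu (A d) + (e * d)%:E)%E.
  rewrite -Jd//; apply: le_trans (leeD2l _ H).
  apply: le_trans (outer_measureU2 mu _ _).
  by apply: le_outer_measure => z Jz; have [Az|nAz] := pselect (A d z); [left|right].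
move: le1 le2; rewrite -(fineK (fin d d0)) -EFinD -EFinM !lee_fin /= => le1 le2.
have di : 0 < d^-1 by rewrite invr_gt0.
rewrite -[X in `|X - _|](mulVf (lt0r_neq0 d0)) -mulrBr normrM (gtr0_norm di).
by rewrite ler_pdivrMl// mulrC ger0_norm; lra.
Qed.

Lemma density_one_half (A : R -> set R) : density_one A ->
  exists2 r : R, 0 < r & forall d : R, 0 < d < r -> ((d / 2)%:E < mu (A d))%E.
Proof.
move=> dA; have /dA : nbhs 1%:E [set x : \bar R | ((1 / 2)%:E < x)%E].
  apply: open_nbhs_nbhs; split; first exact: open_ereal_gt_ereal.
  by rewrite /= lte_fin; lra.
move=> [/= r r0 Hr]; exists r => // d /andP[d0 dr].
have := Hr d; rewrite /= sub0r normrN gtr0_norm// => /(_ dr d0).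
by rewrite lte_pdivlMl// -EFinM mul1r.
Qed.

Lemma ereal_inf_cut (D : set R) (l : \bar R) :
  (forall t, (l < t%:E)%E -> D t) -> (forall t, D t -> (l <= t%:E)%E) ->
  ereal_inf [set t%:E | t in D] = l.
Proof.
move=> D1 D2; apply/eqP; rewrite eq_le; apply/andP; split; last first.
  by apply: le_ereal_inf_tmp => _ [t /D2 ? <-].
case: l D1 D2 => [l| |] D1 D2; last 2 first.
- exact: leey.
- have : forall t : R, (ereal_inf [set t%:E | t in D] <= t%:E)%E.
    by move=> t; apply: ereal_inf_lbound; exists t => //; apply: D1; rewrite ltNyr.
  case: ereal_inf => [r /(_ (r - 1))|/(_ 0)|]//.
  by rewrite lee_fin => ?; exfalso; lra.
- apply/lee_addgt0Pr => e e0; rewrite -EFinD; apply: ereal_inf_lbound.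
  by exists (l + e) => //; apply: D1; rewrite lte_fin ltrDl.
Qed.

Lemma ereal_sup_cut (D : set R) (l : \bar R) :
  (forall t, (t%:E < l)%E -> D t) -> (forall t, D t -> (t%:E <= l)%E) ->
  ereal_sup [set t%:E | t in D] = l.
Proof.
move=> D1 D2; apply/eqP; rewrite eq_le; apply/andP; split.
  by apply: ge_ereal_sup => _ [t /D2 ? <-].
case: l D1 D2 => [l| |] D1 D2; last 2 first.
- have : forall t : R, (t%:E <= ereal_sup [set t%:E | t in D])%E.
    by move=> t; apply: ereal_sup_ubound; exists t => //; apply: D1; rewrite ltry.
  case: ereal_sup => [r /(_ (r + 1))||/(_ 0)]//.
  by rewrite lee_fin => ?; exfalso; lra.
- exact: leNye.
- apply/lee_addgt0Pr => e e0; rewrite -leeBlDr// -EFinB; apply: ereal_sup_ubound.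
  by exists (l - e) => //; apply: D1; rewrite lte_fin ltrBlDr ltrDl.
Qed.

Section at_point.
Variables (I : set R) (g : R -> R) (y : R) (l : \bar R).
Hypothesis Iy : exists2 r : R, 0 < r & forall z, `|z - y| < r -> I z.
Hypothesis gl : ap_limit g y l.

(* [J d] stands for either of the one-sided neighbourhoods of [y]. *)
Variable J : R -> set R.
Hypothesis Jd : forall d, 0 < d -> mu (J d) = d%:E.
Hypothesis Jy : forall d z, J d z -> 0 < `|z - y| < d.

Let density_small (B : set R) : ap_small y (~` B) ->
  density_one (fun d => [set z | I z /\ J d z /\ B z]).
Proof.
move=> sB; apply: (density_one_small Jd) => [d z [_ []]//|e e0].
have [r r0 Hr] := sB e e0; have [r' r'0 Hr'] := Iy.
exists (Num.min r r'); first by rewrite lt_min r0.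
move=> d; rewrite lt_min => /and3P[d0 dr dr'].
apply: (le_trans _ (Hr d _)); last by rewrite d0.
apply: le_outer_measure => z [Jz nz]; have /andP[zy0 zyd] := Jy Jz.
split; first by rewrite zy0.
by move=> Bz; apply: nz; split => //; apply: Hr'; exact: lt_trans dr'.
Qed.

Let small_not_density (B : set R) : ap_small y B ->
  ~ density_one (fun d => [set z | I z /\ J d z /\ B z]).
Proof.
move=> sB /density_one_half[r r0 Hr].
have [r' r'0 Hr'] := sB (1 / 2) ltac:(lra).
have [d [d0 dr dr']] : exists d : R, [/\ 0 < d, d < r & d < r'].
  exists (Num.min r r' / 2).
  have m0 : 0 < Num.min r r' by rewrite lt_min r0.
  have : Num.min r r' <= r by rewrite ge_min lexx.
  have : Num.min r r' <= r' by rewrite ge_min lexx orbT.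
  by move: (Num.min _ _) m0 => m ? ? ?; split; lra.
have := Hr d; rewrite d0 dr => /(_ isT); apply/negP; rewrite -leNgt.
apply: (le_trans _ (_ : ((1 / 2) * d)%:E <= _)%E); last by rewrite lee_fin; lra.
apply: (le_trans _ (Hr' d _)); last by rewrite d0.
by apply: le_outer_measure => z [_ [/Jy]].
Qed.

Lemma ap_upper_limit : ereal_inf [set t%:E | t in [set t : R | density_one
  (fun d => [set z | I z /\ J d z /\ dq g y z <= t])]] = l.
Proof.
apply: ereal_inf_cut => [t lt|t dt].
  apply: density_small; apply: ap_small_sub ((gl t).1 lt) => z _ /=.
  by move=> /negP; rewrite -ltNge => /ltW.
by rewrite leNgt; apply/negP => tl; exact: small_not_density ((gl t).2 tl) dt.
Qed.

Lemma ap_lower_limit : ereal_sup [set t%:E | t in [set t : R | density_one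
  (fun d => [set z | I z /\ J d z /\ t <= dq g y z])]] = l.
Proof.
apply: ereal_sup_cut => [t lt|t dt].
  apply: density_small; apply: ap_small_sub ((gl t).2 lt) => z _ /=.
  by move=> /negP; rewrite -ltNge => /ltW.
by rewrite leNgt; apply/negP => tl; exact: small_not_density ((gl t).1 tl) dt.
Qed.
End at_point.

Lemma right_measure (y d : R) : 0 < d -> mu [set z | y < z < y + d] = d%:E.
Proof.
move=> d0; rewrite (_ : [set z | _] = `]y, y + d[%classic).
  by rewrite lebesgue_measure_itv/= lte_fin ltrDl d0 -EFinB addrAC subrr add0r.
by apply/seteqP; split => z /=; rewrite in_itv.
Qed.

Lemma left_measure (y d : R) : 0 < d -> mu [set z | y - d < z < y] = d%:E.
Proof.
move=> d0; rewrite (_ : [set z | _] = `]y - d, y[%classic).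
  by rewrite lebesgue_measure_itv/= lte_fin gtrBl d0 -EFinB opprB addrC subrK.
by apply/seteqP; split => z /=; rewrite in_itv.
Qed.

Lemma right_dist (y d z : R) : [set z | y < z < y + d] z -> 0 < `|z - y| < d.
Proof. by move=> /= zy; rewrite ger0_norm; lra. Qed.

Lemma left_dist (y d z : R) : [set z | y - d < z < y] z -> 0 < `|z - y| < d.
Proof. by move=> /= zy; rewrite distrC ger0_norm; lra. Qed.

Lemma ap_limit_D_ap (I : set R) (g : R -> R) (y : R) (l : \bar R) :
  (exists2 r : R, 0 < r & forall z, `|z - y| < r -> I z) ->
  ap_limit g y l -> D_ap I g y.
Proof.
move=> Iy gl; have Rd := @right_measure y; have Ry := @right_dist y.
have Ld := @left_measure y; have Ly := @left_dist y.
have UR : ap_upper_right I g y = l by exact: (ap_upper_limit Iy gl Rd Ry).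
have LR : ap_lower_right I g y = l by exact: (ap_lower_limit Iy gl Rd Ry).
have UL : ap_upper_left I g y = l by exact: (ap_upper_limit Iy gl Ld Ly).
have LL : ap_lower_left I g y = l by exact: (ap_lower_limit Iy gl Ld Ly).
split; last by rewrite UR LR UL LL.
by have [r r0] := Iy; apply; rewrite subrr normr0.
Qed.

(* The half of the neighbourhood farther from [y] carries part of a set of
   relative measure more than one half. *)
Lemma density_one_right (A : R -> set R) (y : R) :
  density_one A -> (forall d z, A d z -> y < z < y + d) ->
  exists2 r : R, 0 < r & forall d : R, 0 < d < r ->
    exists z, A d z /\ y + d / 2 < z < y + d.
Proof.
move=> /density_one_half[r r0 Hr] Ay; exists r => // d /[dup]/Hr Ad /andP[d0 dr].
apply: contrapT => nA; move: Ad; apply/negP; rewrite -leNgt.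
apply: (@le_trans _ _ (mu `]y, y + d / 2]%classic)).
  apply: le_outer_measure => z Az; rewrite /= in_itv/=.
  have /andP[yz zd] := Ay _ _ Az; rewrite yz/= leNgt; apply/negP => zd2.
  by apply: nA; exists z; rewrite zd2.
rewrite lebesgue_measure_itv/= lte_fin ltrDl divr_gt0// -EFinB lee_fin; lra.
Qed.

Lemma density_one_left (A : R -> set R) (y : R) :
  density_one A -> (forall d z, A d z -> y - d < z < y) ->
  exists2 r : R, 0 < r & forall d : R, 0 < d < r ->
    exists z, A d z /\ y - d < z < y - d / 2.
Proof.
move=> /density_one_half[r r0 Hr] Ay; exists r => // d /[dup]/Hr Ad /andP[d0 dr].
apply: contrapT => nA; move: Ad; apply/negP; rewrite -leNgt.
apply: (@le_trans _ _ (mu `[y - d / 2, y[%classic)).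
  apply: le_outer_measure => z Az; rewrite /= in_itv/=.
  have /andP[dz zy] := Ay _ _ Az; rewrite zy andbT leNgt; apply/negP => zd2.
  by apply: nA; exists z; rewrite dz.
rewrite lebesgue_measure_itv/= lte_fin gtrBl divr_gt0// -EFinB lee_fin; lra.
Qed.

End approximate_limits.

(** * Pieces with uniform constants *)

Section pieces.
Variable R : realType.

(** The M-condition for both neighbours of [y], in the sum norm. [N] is both the constant and the
    inverse of the scale, so a single countable index controls the two. *)
Definition two_sided_M (g : R -> R) (N y : R) := forall x z : R,
  y - N^-1 < x < y -> y < z < y + N^-1 ->
  `|g x - g y| <= N * (z - x + `|g x - g z|) /\
  `|g z - g y| <= N * (z - x + `|g x - g z|).

(** What a finite upper approximate derivative leaves at every small scale. The point is asked for
    in the outer half so that, at scale [2 * (y' - y)], it lies beyond [y']. *)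
Definition upper_slope_right (g : R -> R) (N y : R) := forall d : R,
  0 < d < N^-1 -> exists2 z, y + d / 2 < z < y + d & g z - g y <= N * (z - y).

Definition upper_slope_left (g : R -> R) (N y : R) := forall d : R,
  0 < d < N^-1 -> exists2 x, y - d < x < y - d / 2 & g y - g x <= N * (y - x).

(** The radius [N^-1 / 4] keeps two points of a piece at distance below [N^-1 / 2], so twice their
    distance is still an admissible scale. *)
Definition piece (I : set R) (g : R -> R) (N q : R) : set R :=
  [set y | [/\ forall z, `|z - y| < N^-1 -> I z, two_sided_M g N y &
               `|y - q| < N^-1 / 4]].

Section one_piece.
Variables (I : set R) (g : R -> R) (N q : R).
Hypothesis N1 : 1 <= N.
Hypothesis gcont : forall z, I° z -> {for z, continuous g}.

Let N0 : 0 < N. Proof. exact: lt_le_trans ltr01 N1. Qed.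
Let Ni : 0 < N^-1. Proof. by rewrite invr_gt0. Qed.

Let piece_interior y z : piece I g N q y -> `|z - y| < N^-1 -> I° z.
Proof.
move=> [Iy _ _] zy; apply/nbhs_ballP; exists (N^-1 - `|z - y|) => /=.
  by rewrite subr_gt0.
move=> t; rewrite /ball/= => zt; apply: Iy.
have -> : t - y = (z - y) - (z - t) by lra.
by rewrite (le_lt_trans (ler_normB _ _))// addrC -ltrBrDr.
Qed.

Let piece_continuous y s t : piece I g N q y ->
  y - N^-1 < s -> t < y + N^-1 -> {within `[s, t], continuous g}.
Proof.
move=> Py ys ty; apply: continuous_in_subspaceT => z; rewrite inE/= in_itv/= => zst.
by apply/gcont/(piece_interior Py); rewrite ltr_norml; lra.
Qed.

Let piece_dist y y' : piece I g N q y -> piece I g N q y' -> y' - y < N^-1 / 2.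
Proof. by move=> [_ _ +] [_ _]; rewrite !ltr_norml; lra. Qed.

(** With [d = y' - y], the slope bound at scale [2 * d] gives [z] beyond [y'] at height at most
    [g y + 2 * (N * d)]. If [g y'] is higher, the graph returns to that height at some [z'], and the
    M-condition at [y'] for the pair [y], [z'] bounds the rise by [N * (2 * d + 2 * (N * d))]. *)
Lemma piece_slope_right y y' : piece I g N q y -> piece I g N q y' ->
  upper_slope_right g N y -> y < y' ->
  g y' - g y <= N * (2 + 2 * N) * (y' - y).
Proof.
move=> Py Py' Uy yy'; have := piece_dist Py Py'; have N1' := N1; have Ni' := Ni.
have [d dE] : exists d : R, d = y' - y by eexists.
rewrite -dE => dN; have d0 : 0 < d by lra.
have Nd : 0 <= N * d by rewrite mulr_ge0 ?ltW.
have NNd : 0 <= N * (N * d) by rewrite mulr_ge0// ltW.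
have [z /andP[z1 z2] gz] := Uy (2 * d) ltac:(lra).
have {}gz : g z - g y <= 2 * (N * d).
  apply: (le_trans gz); rewrite mulrCA ler_wpM2l ?ltW//; lra.
have [gy'|gy'] := leP (g y') (g y + 2 * (N * d)).
  by have := Nd; have := NNd; lra.
have y'z : y' < z by lra.
have [||z' z'I gz'] := @IVT R g y' z (g y + 2 * (N * d)) (ltW y'z).
- by apply: (piece_continuous Py'); lra.
- by rewrite ge_min le_max; lra.
move: z'I; rewrite in_itv/= => /andP[y'z' z'z].
have {}y'z' : y' < z'.
  by rewrite lt_neqAle y'z' andbT; apply/eqP => yE; move: gy'; rewrite yE gz' ltxx.
have [_ My' _] := Py'.
have [||+ _] := My' y z'; [lra..|].
rewrite gz' [`|g y - g y'|]distrC [`|g y - (_ + _)|]distrC.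
rewrite ger0_norm; last by lra.
rewrite ger0_norm; last by lra.
move=> /le_trans; apply; rewrite -mulrA ler_wpM2l ?ltW//; lra.
Qed.

(** The mirror image: the slope bound is taken at [y'], the M-condition at [y]. *)
Lemma piece_slope_left y y' : piece I g N q y -> piece I g N q y' ->
  upper_slope_left g N y' -> y < y' ->
  g y' - g y <= N * (2 + 2 * N) * (y' - y).
Proof.
move=> Py Py' Uy yy'; have := piece_dist Py Py'; have N1' := N1; have Ni' := Ni.
have [d dE] : exists d : R, d = y' - y by eexists.
rewrite -dE => dN; have d0 : 0 < d by lra.
have Nd : 0 <= N * d by rewrite mulr_ge0 ?ltW.
have NNd : 0 <= N * (N * d) by rewrite mulr_ge0// ltW.
have [x /andP[x1 x2] gx] := Uy (2 * d) ltac:(lra).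
have {}gx : g y' - g x <= 2 * (N * d).
  apply: (le_trans gx); rewrite mulrCA ler_wpM2l ?ltW//; lra.
have [gy'|gy'] := leP (g y') (g y + 2 * (N * d)).
  by have := Nd; have := NNd; lra.
have xy : x < y by lra.
have [||x' x'I gx'] := @IVT R g x y (g y' - 2 * (N * d)) (ltW xy).
- by apply: (piece_continuous Py); lra.
- by rewrite ge_min le_max; lra.
move: x'I; rewrite in_itv/= => /andP[xx' x'y].
have {}x'y : x' < y.
  rewrite lt_neqAle x'y andbT; apply/eqP => yE; move: gx'; rewrite yE; lra.
have [_ My _] := Py.
have [||_] := My x' y'; [lra..|].
rewrite gx' ger0_norm; last by lra.
rewrite distrC ger0_norm; last by lra.
move=> /le_trans; apply; rewrite -mulrA ler_wpM2l ?ltW//; lra.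
Qed.

(** [A] is used as a sign: with [g = - f] and [A = -1] the points still lie on the graph of [f]. *)
Lemma piece_null (A : R) (U : set R) :
  (forall y, U y -> upper_slope_right g N y) \/
  (forall y, U y -> upper_slope_left g N y) ->
  hausdorff_content [set (y, A * g y) | y in
    [set y | [/\ piece I g N q y, U y & ~ exists l, ap_limit g y l]]] = 0%E.
Proof.
move=> HU; pose P := piece I g N q `&` U.
have [PE|/set0P P0] := eqVneq P set0.
  apply: (@hausdorff_content_subset0 _ _ [set (0, 0)]).
    by move=> _ [y [Py Uy _] <-]; have : P y by []; rewrite PE.
  exact: hausdorff_content_set1.
pose C := N * (2 + 2 * N); pose h x := g x - C * x.
have C0 : 0 <= C by rewrite !mulr_ge0 ?addr_ge0 ?mulr_ge0 ?ltW.
pose a := q - N^-1 / 4; pose b := q + N^-1 / 4.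
have [p0 [Pp0 Up0]] := P0.
have Pab : P `<=` `]a, b[%classic.
  by move=> y [[_ _ yq] _]; rewrite /= in_itv/=; move: yq; rewrite ltr_norml /a /b; lra.
have hcont : {in `]a, b[, continuous h}.
  move=> z; rewrite in_itv/= => zab.
  apply: cvgB; last by apply: cvgM; [exact: cvg_cst|exact: cvg_id].
  apply/gcont/(piece_interior Pp0); case: Pp0 => _ _; move: zab Ni.
  by rewrite !ltr_norml /a /b; lra.
have h_ni (p p' : R) : P p -> P p' -> p <= p' -> h p' <= h p.
  move=> [Pp Up] [Pp' Up']; rewrite le_eqVlt => /predU1P[->//|pp'].
  suff : g p' - g p <= C * (p' - p) by rewrite /h; lra.
  by case: HU => HU; [apply: piece_slope_right|apply: piece_slope_left] => //; exact: HU.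
(* [N] is the M-constant of [g]; [N * C] pays for replacing [g] by [h] on the right-hand side of the
   M-condition, and [C] on the left-hand side. *)
pose c := N + N * C + C.
have NC0 : 0 <= N * C by rewrite mulr_ge0// ltW.
have c1 : 1 <= c by rewrite /c; have := N1; lra.
have hM (p x z : R) : P p -> a < x < p -> p < z < b ->
    `|h x - h p| <= c * (z - x + `|h x - h z|) /\
    `|h z - h p| <= c * (z - x + `|h x - h z|).
  move=> [[_ Mp pq] _] xp pz.
  have [||M1 M2] := Mp x z.
  - by move: pq xp pz Ni; rewrite ltr_norml /a /b; lra.
  - by move: pq xp pz Ni; rewrite ltr_norml /a /b; lra.
  have zx : 0 <= z - x by lra.
  have Cz u v : x <= u <= z -> x <= v <= z -> `|C * (u - v)| <= C * (z - x).
    by move=> ? ?; rewrite normrM (ger0_norm C0) ler_wpM2l// ler_norml; lra.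
  have gh u v : x <= u <= z -> x <= v <= z -> `|h u - h v| <= `|g u - g v| + C * (z - x).
    move=> xu xv; have -> : h u - h v = (g u - g v) - C * (u - v) by rewrite /h; ring.
    by rewrite (le_trans (ler_normB _ _))// lerD2l Cz.
  have hg : `|g x - g z| <= `|h x - h z| + C * (z - x).
    have -> : g x - g z = (h x - h z) + C * (x - z) by rewrite /h; ring.
    by rewrite (le_trans (ler_normD _ _))// lerD2l Cz; lra.
  have key : N * (z - x + `|g x - g z|) + C * (z - x) <= c * (z - x + `|h x - h z|).
    have H1 : N * `|g x - g z| <= N * (`|h x - h z| + C * (z - x)).
      by rewrite ler_wpM2l// ltW.
    have H2 : 0 <= (N * C + C) * `|h x - h z|.
      by rewrite mulr_ge0// addr_ge0// mulr_ge0// ltW.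
    by rewrite /c; lra.
  split; apply: le_trans key.
    by apply: (le_trans (gh _ _ _ _)); [lra..|rewrite lerD2r].
  by apply: (le_trans (gh _ _ _ _)); [lra..|rewrite lerD2r].
have := @monotone_piece_null R a b c h P c1 hcont P0 Pab h_ni hM A (A * C).
apply: hausdorff_content_subset0 => _ [y [Py Uy nl] <-].
exists y; last by rewrite /h; congr (_, _); ring.
split => // -[[l hl]|hl]; apply: nl.
  exists (l%:E + C%:E)%E; apply: ap_limit_shear (ap_slope_limit hl) => x.
  by rewrite /h subrK.
exists (-oo + C%:E)%E; apply: ap_limit_shear (slope_Ny_limit hl) => x.
by rewrite /h subrK.
Qed.

End one_piece.
End pieces.

(** * Points with a derivative are M-points *)

Section derivative_M_point.
Variable R : realType.
Implicit Types (I : set R) (f : R -> R).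

Lemma dist2_homo (p q r : R * R) : `|p.1 - q.1| <= `|p.1 - r.1| ->
  `|p.2 - q.2| <= `|p.2 - r.2| -> dist2 p q <= dist2 p r.
Proof.
move=> h1 h2; rewrite /dist2 ler_wsqrtr//; apply: lerD.
  by rewrite -real_normK ?num_real// -[leRHS]real_normK ?num_real// lerXn2r.
by rewrite -real_normK ?num_real// -[leRHS]real_normK ?num_real// lerXn2r.
Qed.

(** For a finite derivative, the left side is at most [|l| + 2] times [y - x]: [|l| + 1] for the
    ordinate and 1 for the abscissa. For an infinite one [f] crosses the value [f y] at [y], so
    replacing [y] by [z] enlarges both coordinate differences and the constant 1 works. *)
Lemma ext_derivative_M_point I f y : I y -> has_ext_derivative I f y ->
  M_point I f y.
Proof.
move=> Iy [l dl].
have near_l (B : set (\bar R)) : nbhs l B ->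
    exists2 r : R, 0 < r & forall z, I z -> z != y -> `|z - y| < r -> B (dq f y z)%:E.
  move=> /dl /nbhs_ballP[r /= r0 Hr]; exists r => // z Iz zy zr.
  by apply: Hr => //; rewrite /ball/= distrC.
case: l dl near_l => [l| |] dl near_l.
- have [|r r0 Hr] := near_l [set u | ((l - 1)%:E < u < (l + 1)%:E)%E].
    apply: open_nbhs_nbhs; split; last by rewrite /= !lte_fin; lra.
    rewrite [X in open X](_ : _ = [set u | ((l - 1)%:E < u)%E] `&` [set u | (u < (l + 1)%:E)%E]).
      by apply: openI; [exact: open_ereal_gt_ereal|exact: open_ereal_lt_ereal].
    by apply/seteqP; split => u /= => [/andP[]|[-> ->]].
  have l0 := normr_ge0 l.
  exists (`|l| + 2); first by lra.
  split => //; exists r => // x z Ix xy Iz yz.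
  have xy0 : x - y < 0 by lra.
  have : (l - 1 < dq f y x < l + 1)%R.
    have := Hr x Ix; rewrite /= !lte_fin; apply; first by rewrite lt_eqF//; lra.
    by rewrite ltr_norml; lra.
  move=> dx; have fx : f x - f y = dq f y x * (x - y).
    by rewrite /dq divfK// lt_eqF.
  apply: (@le_trans _ _ ((`|l| + 2) * (z - x))); last first.
    rewrite ler_wpM2l//.
    apply: (le_trans _ (dist2_ge1 _ _)); rewrite /= distrC ger0_norm; lra.
  apply: (@le_trans _ _ ((`|l| + 2) * (y - x))); last first.
    by rewrite ler_wpM2l//; lra.
  apply: (le_trans (dist2_le _ _)); rewrite /graphpt/= fx normrM (ltr0_norm xy0) opprB.
  have dl1 : `|dq f y x| <= `|l| + 1.
    by have := ler_norm l; have := ler_norm (- l); rewrite normrN ler_norml; lra.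
  have : `|dq f y x| * (y - x) <= (`|l| + 1) * (y - x) by rewrite ler_wpM2r//; lra.
  by lra.
- have [|r r0 Hr] := near_l [set u | (0%:E < u)%E].
    by apply: open_nbhs_nbhs; split; [exact: open_ereal_gt_ereal|exact: ltry].
  exists 1 => //; split => //; exists r => // x z Ix xy Iz yz; rewrite mul1r.
  have : 0 < dq f y x.
    have := Hr x Ix; rewrite /= lte_fin; apply; first by rewrite lt_eqF//; lra.
    by rewrite ltr_norml; lra.
  have : 0 < dq f y z.
    have := Hr z Iz; rewrite /= lte_fin; apply; first by rewrite gt_eqF//; lra.
    by rewrite ltr_norml; lra.
  rewrite /dq pmulr_lgt0; last by rewrite invr_gt0; lra.
  rewrite nmulr_lgt0; last by rewrite invr_lt0; lra.
  move=> fz fx; apply: dist2_homo => /=; by rewrite ler0_norm ?ler0_norm; lra.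
- have [|r r0 Hr] := near_l [set u | (u < 0%:E)%E].
    by apply: open_nbhs_nbhs; split; [exact: open_ereal_lt_ereal|exact: ltNyr].
  exists 1 => //; split => //; exists r => // x z Ix xy Iz yz; rewrite mul1r.
  have : dq f y x < 0.
    have := Hr x Ix; rewrite /= lte_fin; apply; first by rewrite lt_eqF//; lra.
    by rewrite ltr_norml; lra.
  have : dq f y z < 0.
    have := Hr z Iz; rewrite /= lte_fin; apply; first by rewrite gt_eqF//; lra.
    by rewrite ltr_norml; lra.
  rewrite /dq pmulr_llt0; last by rewrite invr_gt0; lra.
  rewrite nmulr_llt0; last by rewrite invr_lt0; lra.
  move=> fz fx; apply: dist2_homo => /=.
    by rewrite ler0_norm ?ler0_norm; lra.
  by rewrite ger0_norm ?ger0_norm; lra.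
Qed.

End derivative_M_point.

(** * Approximate knot points in the interior are knot points *)

Section knot_points.
Variable R : realType.
Implicit Types (I : set R) (f : R -> R).
Local Notation mu := (@lebesgue_measure R).

(** Otherwise some real [t] bounds [u] on a whole one-sided neighbourhood, where the sublevel set
    then has density one. [J] stands for either side, and [u] for the quotient or its opposite,
    which covers all four Dini derivatives. *)
Lemma limf_esup_pinfty I (J : R -> set R) (F : set_system R) (y : R) (u : R -> R) :
  (exists2 r : R, 0 < r & forall z, `|z - y| < r -> I z) ->
  (forall d, 0 < d -> mu (J d) = d%:E) ->
  (forall d z, J d z -> 0 < `|z - y| < d) ->
  (forall V, F V -> exists2 r : R, 0 < r &
    forall d z, d < r -> I z -> J d z -> V z) ->
  ~ (exists t : R, density_one (fun d => [set z | I z /\ J d z /\ u z <= t])) ->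
  limf_esup (fun z => (u z)%:E) F = +oo%E.
Proof.
move=> [r1 r10 I1] Jd Jy FJ nt; apply/eqP; rewrite -leye_eq leNgt; apply/negP.
move=> /ereal_inf_lt[_ /= [V FV <-]] supV.
have [r2 r20 H2] := FJ V FV.
have [t supt] : exists t : R, (ereal_sup [set (u z)%:E | z in V] <= t%:E)%E.
  by move: supV; case: ereal_sup => [t _|//|_]; [exists t|exists 0; exact: leNye].
apply: nt; exists t; apply: (density_one_small Jd) => [d z [_ []]//|e e0].
exists (Num.min r1 r2); first by rewrite lt_min r10.
move=> d; rewrite lt_min => /and3P[d0 dr1 dr2].
rewrite [X in (mu X <= _)%E](_ : _ = set0).
  by rewrite measure0 lee_fin mulr_ge0 ?ltW.
rewrite -subset0 => z [Jz]; apply; have /andP[zy0 zyd] := Jy _ _ Jz.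
have Iz : I z by apply: I1; exact: lt_trans dr1.
split => //; split => //; rewrite -lee_fin; apply: le_trans supt.
by apply: ereal_sup_ubound; exists z => //; exact: (H2 d).
Qed.

Lemma K_ap_knot_point I f y :
  (exists2 r : R, 0 < r & forall z, `|z - y| < r -> I z) ->
  K_ap I f y -> knot_point I f y.
Proof.
move=> Iy [_ [UR [UL [LR LL]]]].
have FR V : within I (y^'+) V -> exists2 r : R, 0 < r &
    forall d z, d < r -> I z -> [set z | y < z < y + d] z -> V z.
  move=> /nbhs_ballP[r /= r0 Hr]; exists r => // d z dr Iz /= yz.
  by apply: Hr => //; [rewrite /ball/= distrC ger0_norm|]; lra.
have FL V : within I (y^'-) V -> exists2 r : R, 0 < r &
    forall d z, d < r -> I z -> [set z | y - d < z < y] z -> V z.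
  move=> /nbhs_ballP[r /= r0 Hr]; exists r => // d z dr Iz /= yz.
  by apply: Hr => //; [rewrite /ball/= ger0_norm|]; lra.
split; [|split; [|split]].
- apply: (limf_esup_pinfty Iy (@right_measure R y) (@right_dist R y) FR) => -[t dt].
  have : (ap_upper_right I f y <= t%:E)%E by apply: ereal_inf_lbound; exists t.
  by rewrite UR.
- apply: (limf_esup_pinfty Iy (@left_measure R y) (@left_dist R y) FL) => -[t dt].
  have : (ap_upper_left I f y <= t%:E)%E by apply: ereal_inf_lbound; exists t.
  by rewrite UL.
- rewrite /dini_lower_right /limf_einf; apply/eqP; rewrite eqe_oppLR/=; apply/eqP.
  apply: (@limf_esup_pinfty I _ _ y (fun z => - dq f y z) Iy
    (@right_measure R y) (@right_dist R y) FR) => -[t dt].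
  have : ((- t)%:E <= ap_lower_right I f y)%E.
    apply: ereal_sup_ubound; exists (- t) => //=.
    by under eq_fun do under eq_set do rewrite lerNl.
  by rewrite LR.
- rewrite /dini_lower_left /limf_einf; apply/eqP; rewrite eqe_oppLR/=; apply/eqP.
  apply: (@limf_esup_pinfty I _ _ y (fun z => - dq f y z) Iy
    (@left_measure R y) (@left_dist R y) FL) => -[t dt].
  have : ((- t)%:E <= ap_lower_left I f y)%E.
    apply: ereal_sup_ubound; exists (- t) => //=.
    by under eq_fun do under eq_set do rewrite lerNl.
  by rewrite LL.
Qed.

End knot_points.

(** * Countable decomposition of the exceptional set *)

Section decomposition.
Variable R : realType.
Variables (I : set R) (f : R -> R).
Hypothesis Iitv : is_interval I.
Hypothesis fcont : {within I, continuous f}.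

(** Conditions true for all large [N] can be combined and then met at a natural number, whence the
    countable index set. *)
Definition eventually_large (P : R -> Prop) :=
  exists N0 : R, forall N, N0 <= N -> P N.

Lemma eventually_large_inv (r : R) : 0 < r ->
  eventually_large (fun N => 0 < N /\ N^-1 <= r).
Proof.
move=> r0; exists r^-1 => N rN.
have N0 : 0 < N by apply: lt_le_trans rN; rewrite invr_gt0.
by split => //; rewrite -[leRHS]invrK lef_pV2// posrE invr_gt0.
Qed.

Lemma interior_ball y : I° y ->
  exists2 r : R, 0 < r & forall z, `|z - y| < r -> I z.
Proof.
move=> /nbhs_ballP[r /= r0 Hr]; exists r => // z zy.
by apply: Hr; rewrite /ball/= distrC.
Qed.

Lemma interior_continuous z : I° z -> {for z, continuous f}.
Proof.
move=> Iz; have := continuous_subspaceW (@interior_subset _ I) fcont.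
rewrite continuous_open_subspace; last exact: open_interior.
by apply; rewrite inE.
Qed.

Lemma M_point_two_sided y : M_point I f y -> I° y -> eventually_large (fun N =>
  two_sided_M f N y /\ forall z, `|z - y| < N^-1 -> I z).
Proof.
move=> [c c1 [Iy [e e0 Me]]] /interior_ball[r r0 Ir].
have [N1 HN1] := eventually_large_inv e0.
have [N2 HN2] := eventually_large_inv r0.
(* [1 + c] serves the right neighbour [z], compared with [y] through [x] by the triangle
   inequality. *)
exists (Num.max (1 + c) (Num.max N1 N2)) => N.
rewrite !ge_max => /and3P[cN /HN1[N0 Ne] /HN2[_ Nr]]; split; last first.
  by move=> z zN; apply: Ir; exact: lt_le_trans Nr.
move=> x z xy yz.
have Ix : I x by apply: Ir; apply: lt_le_trans Nr; rewrite ltr_norml; lra.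
have Iz : I z by apply: Ir; apply: lt_le_trans Nr; rewrite ltr_norml; lra.
have := Me x z Ix ltac:(lra) Iz ltac:(lra).
move=> /(le_trans (dist2_ge2 _ _)); rewrite /graphpt/= => M1.
have zx : 0 <= z - x by lra.
have D0 : 0 <= z - x + `|f x - f z| by rewrite addr_ge0.
have cD : c * dist2 (x, f x) (z, f z) <= c * (z - x + `|f x - f z|).
  rewrite ler_wpM2l//; first by lra.
  by rewrite (le_trans (dist2_le _ _))//= distrC (ger0_norm zx).
have ND : (1 + c) * (z - x + `|f x - f z|) <= N * (z - x + `|f x - f z|).
  by rewrite ler_wpM2r.
split; first by lra.
have := ler_distD (f x) (f z) (f y); rewrite [`|f z - f x|]distrC; lra.
Qed.

Lemma two_sided_M_opp (g : R -> R) N y :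
  two_sided_M g N y -> two_sided_M (\- g) N y.
Proof.
move=> Mg x z xy yz; have [] := Mg x z xy yz.
have E u v : `|(\- g) u - (\- g) v| = `|g u - g v|.
  by rewrite /= -opprD normrN.
by rewrite !E.
Qed.

Lemma upper_slope_rightW (g : R -> R) (r t y : R) : 0 < r ->
  (forall d : R, 0 < d < r -> exists2 z, y + d / 2 < z < y + d & g z - g y <= t * (z - y)) ->
  eventually_large (fun N => upper_slope_right g N y).
Proof.
move=> r0 Hr; have [N1 HN1] := eventually_large_inv r0.
exists (Num.max t N1) => N; rewrite ge_max => /andP[tN /HN1[N0 Nr]] d /andP[d0 dN].
have [|z yz gz] := Hr d; first by rewrite d0 (lt_le_trans dN).
by exists z => //; rewrite (le_trans gz)// ler_wpM2r//; lra.
Qed.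

Lemma upper_slope_leftW (g : R -> R) (r t y : R) : 0 < r ->
  (forall d : R, 0 < d < r -> exists2 x, y - d < x < y - d / 2 & g y - g x <= t * (y - x)) ->
  eventually_large (fun N => upper_slope_left g N y).
Proof.
move=> r0 Hr; have [N1 HN1] := eventually_large_inv r0.
exists (Num.max t N1) => N; rewrite ge_max => /andP[tN /HN1[N0 Nr]] d /andP[d0 dN].
have [|z yz gz] := Hr d; first by rewrite d0 (lt_le_trans dN).
by exists z => //; rewrite (le_trans gz)// ler_wpM2r//; lra.
Qed.

(** An approximate Dini derivative that misses its infinite value leaves a real [t] whose level
    condition has density one. Lower derivatives become upper ones on passing to [- f]. *)
Lemma not_K_ap y : I y -> ~ K_ap I f y ->
  [\/ eventually_large (fun N => upper_slope_right f N y),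
      eventually_large (fun N => upper_slope_left f N y),
      eventually_large (fun N => upper_slope_right (\- f) N y) |
      eventually_large (fun N => upper_slope_left (\- f) N y)].
Proof.
move=> Iy nK.
have inf_ex (D : set R) : ereal_inf [set t%:E | t in D] <> +oo%E -> exists t, D t.
  move=> /eqP; rewrite -ltey => /ereal_inf_lt[_ [t Dt _] _]; by exists t.
have sup_ex (D : set R) : ereal_sup [set t%:E | t in D] <> -oo%E -> exists t, D t.
  move=> /eqP; rewrite -ltNye => /ereal_sup_gt[_ [t Dt _] _]; by exists t.
have [UR|/inf_ex[t dt]] := pselect (ap_upper_right I f y = +oo%E); last first.
  constructor 1.
  have [|r r0 Hr] := @density_one_right R _ y dt; first by move=> d z [_ []].
  apply: (@upper_slope_rightW _ r t) => // d /Hr[z [[_ [yz tz]] yz']].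
  by exists z => //; rewrite -ler_pdivrMr//; lra.
have [UL|/inf_ex[t dt]] := pselect (ap_upper_left I f y = +oo%E); last first.
  constructor 2.
  have [|r r0 Hr] := @density_one_left R _ y dt; first by move=> d z [_ []].
  apply: (@upper_slope_leftW _ r t) => // d /Hr[z [[_ [yz tz]] yz']].
  exists z => //; rewrite -ler_pdivrMr; last by lra.
  by rewrite -mulrNN -invrN !opprB.
have [LR|/sup_ex[t dt]] := pselect (ap_lower_right I f y = -oo%E); last first.
  constructor 3.
  have [|r r0 Hr] := @density_one_right R _ y dt; first by move=> d z [_ []].
  apply: (@upper_slope_rightW _ r (- t)) => // d /Hr[z [[_ [yz tz]] yz']].
  exists z => //; move: tz; rewrite /dq ler_pdivlMr/=; lra.
have [LL|/sup_ex[t dt]] := pselect (ap_lower_left I f y = -oo%E); last first.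
  constructor 4.
  have [|r r0 Hr] := @density_one_left R _ y dt; first by move=> d z [_ []].
  apply: (@upper_slope_leftW _ r (- t)) => // d /Hr[z [[_ [yz tz]] yz']].
  exists z => //; move: tz; rewrite /dq -mulrNN -invrN !opprB ler_pdivlMr/=; lra.
by exfalso; apply: nK.
Qed.

Let g := \- f.
Let q_ (m : nat) : R := ratr (odflt 0 (@unpickle rat m)).
Let q_dense (y e : R) : 0 < e -> exists m, `|y - q_ m| < e.
Proof.
move=> e0; have [|q] := @rat_in_itvoo R (y - e) (y + e); first by lra.
by rewrite in_itv/= => yq; exists (pickle q); rewrite /q_ pickleK/= ltr_norml; lra.
Qed.

Let T (k : R -> R) (A : R) (U : (R -> R) -> R -> R -> Prop) (n m : nat) : set (plane R) :=
  [set (y, A * k y) | y in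
    [set y | [/\ piece I k n.+1%:R (q_ m) y, U k n.+1%:R y &
                ~ exists l, ap_limit k y l]]].
Let TT n m := (T f 1 (@upper_slope_right R) n m `|` T f 1 (@upper_slope_left R) n m)
  `|` (T g (-1) (@upper_slope_right R) n m `|` T g (-1) (@upper_slope_left R) n m).

Let TT0 n m : hausdorff_content (TT n m) = 0%E.
Proof.
have n1 : 1 <= n.+1%:R :> R by rewrite ler1n.
have gcont z : I° z -> {for z, continuous g}.
  by move=> /interior_continuous; exact: continuousN.
have fcont' := interior_continuous.
apply: hausdorff_contentU0; apply: hausdorff_contentU0; apply: piece_null => //.
- by left.
- by right.
- by left.
- by right.
Qed.

(* [K_ap] holds vacuously on the outer side of an endpoint of [I], where it does
   not yield a knot point; hence the restriction to the interior. *)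
Definition exceptional_set : set R :=
  [set y | M_point I f y /\ ~ (D_ap I f y \/ K_ap I f y /\ I° y)].

Lemma exceptional_interior y : exceptional_set y -> I° y ->
  (\bigcup_n \bigcup_m TT n m) (graphpt f y).
Proof.
move=> [My /not_orP[nD nK]] Iy; have [r r0 Ir] := interior_ball Iy.
have Iy' := interior_subset Iy.
have {}nK : ~ K_ap I f y by move=> K; apply: nK.
have nf : ~ exists l, ap_limit f y l.
  by move=> [l fl]; apply: nD; apply: ap_limit_D_ap fl; exists r.
have ng : ~ exists l, ap_limit g y l.
  move=> [l gl]; apply: nf; exists (- l)%E; apply: ap_limit_opp gl => x.
  by rewrite /g /= opprK.
have [N1 HN1] := M_point_two_sided My Iy.
have [N2 HN2] : eventually_large (fun N => forall m, `|y - q_ m| < N^-1 / 4 ->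
    [\/ [/\ piece I f N (q_ m) y & upper_slope_right f N y],
        [/\ piece I f N (q_ m) y & upper_slope_left f N y],
        [/\ piece I g N (q_ m) y & upper_slope_right g N y] |
        [/\ piece I g N (q_ m) y & upper_slope_left g N y]]).
  by case: (not_K_ap Iy' nK) => -[N2 HN2]; exists (Num.max N1 N2) => N;
    rewrite ge_max => /andP[/HN1[MN IN] /HN2 UN] m ym;
    [constructor 1|constructor 2|constructor 3|constructor 4]; split => //;
    split => //; exact: two_sided_M_opp.
pose n := Num.bound `|N2|; have /HN2 Hn : N2 <= n.+1%:R.
  rewrite (le_trans (ler_norm _))//.
  by rewrite (le_trans (ltW (archi_boundP (normr_ge0 N2))))// ler_nat.
have [|m ym] := @q_dense y ((n.+1%:R)^-1 / 4).
  by rewrite divr_gt0// invr_gt0.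
exists n => //; exists m => //.
case: (Hn m ym) => -[Py Uy].
- by left; left; exists y => //; rewrite mul1r.
- by left; right; exists y => //; rewrite mul1r.
- by right; left; exists y => //; rewrite /g /= mulN1r opprK.
- by right; right; exists y => //; rewrite /g /= mulN1r opprK.
Qed.

Let subsingleton_null (A : set R) : (forall x y, A x -> A y -> x = y) ->
  hausdorff_content (graphpt f @` A) = 0%E.
Proof.
move=> A1; have [->|/set0P[x Ax]] := eqVneq A set0.
  rewrite image_set0; apply: hausdorff_content_subset0 (hausdorff_content_set1 (0, 0)).
  exact: sub0set.
apply: hausdorff_content_subset0 (hausdorff_content_set1 (graphpt f x)).
by move=> _ [y Ay <-]; rewrite (A1 _ _ Ay Ax).
Qed.

(** Interior points are covered by the pieces; a non-interior point of an interval is its minimum or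
    maximum, which adds at most two points of the graph. *)
Lemma exceptional_set_null : hausdorff_content (graphpt f @` exceptional_set) = 0%E.
Proof.
pose L := [set y | I y /\ forall z, I z -> y <= z].
pose U := [set y | I y /\ forall z, I z -> z <= y].
have L0 : hausdorff_content (graphpt f @` L) = 0%E.
  apply: subsingleton_null => x y [Ix Lx] [Iy Ly].
  by apply/eqP; rewrite eq_le Lx// Ly.
have U0 : hausdorff_content (graphpt f @` U) = 0%E.
  apply: subsingleton_null => x y [Ix Ux] [Iy Uy].
  by apply/eqP; rewrite eq_le Ux// Uy.
have T0 : hausdorff_content (\bigcup_n \bigcup_m TT n m) = 0%E.
  by apply: hausdorff_content_bigcup0 => n; apply: hausdorff_content_bigcup0.
have := hausdorff_contentU0 T0 (hausdorff_contentU0 L0 U0).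
apply: hausdorff_content_subset0 => _ [y Ey <-].
have Iy : I y by case: Ey => -[c _ []].
have [Iy'|nIy] := pselect (I° y); first by left; exact: exceptional_interior.
right; apply: contrapT => /not_orP[nL nU]; apply: nIy.
have [a [Ia ay]] : exists a, I a /\ a < y.
  apply: contrapT => na; apply: nL; exists y => //; split => // z Iz.
  by rewrite leNgt; apply/negP => zy; apply: na; exists z.
have [b [Ib yb]] : exists b, I b /\ y < b.
  apply: contrapT => nb; apply: nU; exists y => //; split => // z Iz.
  by rewrite leNgt; apply/negP => zy; apply: nb; exists z.
have yab : y \in `]a, b[ by rewrite in_itv/= ay.
apply: filterS (near_in_itvoo yab) => z; rewrite in_itv/= => /andP[az zb].
by apply: (Iitv Ia Ib); rewrite !ltW.
Qed.

End decomposition.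

Theorem theorem3p2 (R : realType) (I : set R) (f : R -> R) :
  is_interval I -> (exists a b, I a /\ I b /\ a < b) ->
  {within I, continuous f} ->
  (* (i) *)
  (forall x, I x -> has_ext_derivative I f x -> M_point I f x) /\
  (* (ii) *)
  (exists E : set R, E `<=` I /\ hausdorff1 (graphpt f @` E) = 0%E /\
     forall x, M_point I f x -> (D_ap I f `|` K_ap I f `|` E) x) /\
  (* in particular *)
  (exists N : set R, N `<=` I /\ hausdorff1 (graphpt f @` N) = 0%E /\
     forall x, M_point I f x -> ~ D_ap I f x -> N x \/ knot_point I f x).
Proof.
move=> Iitv _ fcont.
have EI : exceptional_set I f `<=` I by move=> y [[c _ []]].
have E0 := hausdorff_content0 (exceptional_set_null Iitv fcont).
split; first exact: ext_derivative_M_point.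
(* One set serves both claims: an M-point outside it and not in [D_ap] is an approximate knot point
   in the interior. *)
split; exists (exceptional_set I f); split => //; split => // y My.
  have [|nDK] := pselect (D_ap I f y \/ K_ap I f y /\ I° y); last by right.
  by move=> [Dy|[Ky _]]; left; [left|right].
move=> nD; have [[//|[Ky Iy]]|nDK] := pselect (D_ap I f y \/ K_ap I f y /\ I° y).
  by right; apply: K_ap_knot_point Ky; exact: interior_ball.
by left.
Qed.
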